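(* Let $\Omega\subset\mathbb{R}^2$ be a bounded domain, and let $S_1,S_2\subset\Omega$. Let $u\in C^{0}(\bar\Omega\setminus S_1)$, $v\in C^0(\bar\Omega\setminus S_2)$, let $S(u)\subset\Omega\setminus S_1$ (resp. $S(v)\subset\Omega\setminus S_2$) be the set of points where $u_x-y=0=u_y+x$ (resp. $v_x-y=0=v_y+x$), and let $S=S_1\cup S_2\cup S(u)\cup S(v)$. Assume $u,v\in C^2(\Omega\setminus S)$ and $\mathcal{H}_1(\bar S)=0$, where $\mathcal H_1$ is the 1-dimensional Hausdorff measure. For $w\in\{u,v\}$ put $N(w)=(w_x-y,w_y+x)/\sqrt{(w_x-y)^2+(w_y+x)^2}$ on $\Omega\setminus S$. Suppose $\operatorname{div}N(u)\ge\operatorname{div}N(v)$ in $\Omega\setminus S$ and $u\le v$ on $\partial\Omega\setminus S$. Then $N(u)=N(v)$ in $\Omega^+\setminus S$, where $\Omega^+=\{p\in\Omega: u(p)-v(p)>0\}$.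
   Context: $\operatorname{div}$ is the Euclidean divergence in the plane. *)

(* Defs.v *)
From HB Require Import structures.
From mathcomp Require Import all_boot all_order all_algebra.
From mathcomp Require Import all_classical all_reals all_analysis.
Set Implicit Arguments. Unset Strict Implicit. Unset Printing Implicit Defensive.
Import Order.TTheory GRing.Theory Num.Theory.
Import numFieldNormedType.Exports.
Local Open Scope classical_set_scope.
Local Open Scope ring_scope.

Section Defs.
Variable R : realType.
Implicit Types (A : set (R * R)) (f : R * R -> R) (p q : R * R).

Definition edist p q : R := Num.sqrt ((p.1 - q.1) ^+ 2 + (p.2 - q.2) ^+ 2).

(* Euclidean diameter (0 for the empty set, +oo for unbounded sets) *)
Definition ediam A : \bar R :=
  ereal_sup ([set 0%E] `|` [set (edist pq.1 pq.2)%:E | pq in A `*` A]).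

Definition hausdorff1_delta (delta : R) A : \bar R :=
  ereal_inf [set (\sum_(0 <= i <oo) ediam (C i))%E |
     C in [set C : nat -> set (R * R) |
             A `<=` \bigcup_i C i /\ (forall i, (ediam (C i) <= delta%:E)%E)]].

(* 1-dimensional Hausdorff measure: limit as delta -> 0+ (= sup over delta > 0) *)
Definition hausdorff1 A : \bar R :=
  ereal_sup [set hausdorff1_delta delta A | delta in [set d : R | 0 < d]].

Definition partial_x f p : R := derive1 (fun t => f (t, p.2)) p.1.
Definition partial_y f p : R := derive1 (fun t => f (p.1, t)) p.2.
Definition has_partials f p : Prop :=
  derivable (fun t => f (t, p.2)) p.1 1 /\ derivable (fun t => f (p.1, t)) p.2 1.

Definition C2_on A f : Prop :=
  exists U : set (R * R), [/\ open U, A `<=` U &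
    forall p, U p ->
      [/\ has_partials f p, has_partials (partial_x f) p,
          has_partials (partial_y f) p &
          [/\ {for p, continuous f},
              {for p, continuous (partial_x f)}, {for p, continuous (partial_y f)} &
              [/\ {for p, continuous (partial_x (partial_x f))},
                  {for p, continuous (partial_y (partial_x f))},
                  {for p, continuous (partial_x (partial_y f))} &
                  {for p, continuous (partial_y (partial_y f))}]]]].

Definition bounded_domain A : Prop :=
  [/\ A !=set0, open A, connected A &
      exists M : R, forall p, A p -> edist p (0, 0) <= M].

Definition char_set (Omega S0 : set (R * R)) f : set (R * R) :=
  [set p | (Omega `\` S0) p /\ has_partials f p /\
           partial_x f p - p.2 = 0 /\ partial_y f p + p.1 = 0].

Definition Nfield f p : R * R :=
  let a := partial_x f p - p.2 in
  let b := partial_y f p + p.1 in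
  (a / Num.sqrt (a ^+ 2 + b ^+ 2), b / Num.sqrt (a ^+ 2 + b ^+ 2)).

Definition div (F : R * R -> R * R) p : R :=
  partial_x (fun q => (F q).1) p + partial_y (fun q => (F q).2) p.

End Defs.

(* Main.v *)
Require Import Defs.
From HB Require Import structures.
From mathcomp Require Import all_boot all_order all_algebra.
From mathcomp Require Import all_classical all_reals all_analysis.
From mathcomp Require Import ring lra.
Set Implicit Arguments. Unset Strict Implicit. Unset Printing Implicit Defensive.
Import Order.TTheory GRing.Theory Num.Theory.
Import numFieldNormedType.Exports.
Local Open Scope classical_set_scope.
Local Open Scope ring_scope.

(* Put w = u - v and F = N(u) - N(v). Writing the slopes as X = s n and X' = s' m
with unit vectors n and m, F . grad w = (s + s') / 2 * |n - m|^2 is nonnegative and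
vanishes only where N(u) = N(v). Test div F >= 0 against phi(w) eta, where phi is a
bounded nondecreasing function vanishing on values below w(p) / 2, and eta is a
cutoff vanishing near the closure of S. Then phi(w) eta F is compactly supported in
Omega minus the closure of S, so the total mass of its divergence is 0, whereas
  div (phi(w) eta F) >= eta phi'(w) F . grad w + phi(w) F . grad eta.
As the closure of S is H^1-null, eta can be chosen with grad eta of arbitrarily small
mass, and F . grad w cannot be positive at p. Only continuous, compactly supported
integrands occur, so integrals are replaced by Riemann sums over square grids: the
sum of a divergence is then controlled by telescoping difference quotients. *)

(** * Functions that are C1 along a direction *)

Section DirectionalC1.
Context {R : realType} (e : R * R).
Implicit Types (f g : R * R -> R) (a q : R * R).

Lemma quotient_on_line f a t :
  (fun h : R => h^-1 *: (((fun s : R => f (s *: e + a)) \o shift t) (h *: 1)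
                         - f (t *: e + a))) =
  (fun h : R => h^-1 *: ((f \o shift (t *: e + a)) (h *: e) - f (t *: e + a))).
Proof.
apply/funext => h; rewrite /shift /=; congr (_ *: (f _ - _)).
by rewrite scalerDl -addrA [h *: 1]mulr1.
Qed.

Lemma is_derive_on_line f a t :
  derivable f (t *: e + a) e ->
  is_derive t 1 (fun s : R => f (s *: e + a)) ('D_e f (t *: e + a)).
Proof.
move=> df; split; first by rewrite /derivable quotient_on_line.
by rewrite /derive quotient_on_line.
Qed.

(** Restricting [f] to the line through [a] in direction [e] turns this into the one-variable chain
    rule at parameter [0]. *)
Lemma is_derive_comp_dir f (phi : R -> R) a d :
  derivable f a e -> is_derive (f a) 1 phi d ->
  is_derive a e (phi \o f) (d * 'D_e f a).
Proof.
move=> df dphi.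
have E0 : (0 : R) *: e + a = a by rewrite scale0r add0r.
have line g : (fun h : R => h^-1 *: (((fun s : R => g (s *: e + a)) \o shift 0)
      (h *: 1) - g a)) = (fun h : R => h^-1 *: ((g \o shift a) (h *: e) - g a)).
  by have := quotient_on_line g a 0; rewrite E0.
have dg : is_derive (0 : R) 1 (fun s : R => f (s *: e + a)) ('D_e f a).
  by rewrite -{2}E0; apply: is_derive_on_line; rewrite E0.
have dphi' : is_derive ((fun s : R => f (s *: e + a)) 0) 1 phi d by rewrite /= E0.
have [dpf vpf] := @is_derive1_comp _ _ _ _ _ _ dphi' dg.
split; first by rewrite /derivable -(line (phi \o f)); move: dpf; rewrite /derivable /= E0.
by rewrite -vpf /derive -(line (phi \o f)) /= E0.
Qed.

(* Continuity of the directional derivative is required only at [q]; together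
with differentiability near [q] this is what the mean value theorem needs. *)
Definition C1at f q : Prop :=
  [/\ \forall x \near q, derivable f x e,
      {for q, continuous f} & {for q, continuous ('D_e f)}].

Lemma C1at_near_eq f g q : {near q, f =1 g} -> C1at f q -> C1at g q.
Proof.
move=> fg [df cf cdf].
have fg2 : \forall x \near q, {near x, f =1 g} by exact: near_join.
split.
- by apply: filterS2 fg2 df => x; exact: near_eq_derivable.
- rewrite /prop_for /continuous_at -(nbhs_singleton fg).
  exact: cvg_trans (near_eq_cvg fg) cf.
- have dfg : {near q, 'D_e f =1 'D_e g}.
    by apply: filterS fg2 => x; exact: near_eq_derive.
  rewrite /prop_for /continuous_at -(nbhs_singleton dfg).
  exact: cvg_trans (near_eq_cvg dfg) cdf.
Qed.

Lemma C1at_is_derive f df q :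
  (\forall x \near q, is_derive x e f (df x)) ->
  {for q, continuous f} -> {for q, continuous df} -> C1at f q.
Proof.
move=> fdf cf cdf; split=> //; first by apply: filterS fdf => x [].
have dfE : {near q, df =1 'D_e f} by apply: filterS fdf => x [_ <-].
rewrite /prop_for /continuous_at -(nbhs_singleton dfE).
exact: cvg_trans (near_eq_cvg dfE) cdf.
Qed.

Lemma C1at_cst c q : C1at (cst c) q.
Proof.
apply: (@C1at_is_derive _ (cst 0)); last 2 first.
- exact: cvg_cst.
- exact: cvg_cst.
by near=> x; exact: is_derive_cst.
Unshelve. all: by end_near. Qed.

Lemma C1atD f g q : C1at f q -> C1at g q -> C1at (f + g) q.
Proof.
move=> [df cf cdf] [dg cg cdg].
apply: (@C1at_is_derive _ (fun x => 'D_e f x + 'D_e g x)); last 2 first.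
- exact: cvgD.
- exact: cvgD.
by apply: filterS2 df dg => x /derivableP ? /derivableP ?; exact: is_deriveD.
Qed.

Lemma C1atB f g q : C1at f q -> C1at g q -> C1at (f - g) q.
Proof.
move=> [df cf cdf] [dg cg cdg].
apply: (@C1at_is_derive _ (fun x => 'D_e f x - 'D_e g x)); last 2 first.
- exact: cvgB.
- exact: cvgB.
by apply: filterS2 df dg => x /derivableP ? /derivableP ?; exact: is_deriveB.
Qed.

Lemma C1atM f g q : C1at f q -> C1at g q -> C1at (f * g) q.
Proof.
move=> [df cf cdf] [dg cg cdg].
apply: (@C1at_is_derive _ (fun x => f x * 'D_e g x + g x * 'D_e f x)); last 2 first.
- exact: cvgM.
- by apply: cvgD; exact: cvgM.
by apply: filterS2 df dg => x /derivableP ? /derivableP ?; exact: is_deriveM.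
Qed.

Lemma C1at_comp f (phi dphi : R -> R) q : C1at f q ->
  (\forall s \near f q, is_derive (s : R) 1 phi (dphi s)) ->
  {for f q, continuous dphi} -> C1at (phi \o f) q.
Proof.
move=> [df cf cdf] dp cdp.
have dpq := nbhs_singleton dp.
apply: (@C1at_is_derive _ (fun x => dphi (f x) * 'D_e f x)); last 2 first.
- apply: continuous_comp cf _; apply: differentiable_continuous.
  by apply/derivable1_diffP; case: dpq.
- by apply: cvgM => //; exact: (continuous_comp cf cdp).
have dpf : \forall x \near q, is_derive (f x) 1 phi (dphi (f x)).
  exact: (cf _ dp).
by apply: filterS2 df dpf => x dfx dpx; exact: is_derive_comp_dir dfx dpx.
Qed.

Lemma C1at_derivable f q : C1at f q -> derivable f q e.
Proof. by case=> /nbhs_singleton. Qed.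

(** By the mean value theorem on the segment from [a] to [h *: e + a], the error is [h] times a
    variation of ['D_e f] near [q]. The bound is joint in [a] and [h], the form that compactness can
    make uniform. *)
Lemma C1at_difference_quotient f q (eps : R) : C1at f q -> 0 < eps ->
  \forall a \near q & h \near 0^'+,
    `|f (h *: e + a) - f a - h * 'D_e f a| <= eps * h.
Proof.
move=> [df cf cdf] e0.
have e20 : 0 < eps / 2 by rewrite divr_gt0.
have : \forall x \near q, derivable f x e /\ `|'D_e f q - 'D_e f x| < eps / 2.
  have /cvgr_dist_lt/(_ _ e20) cdfe := cdf.
  by apply: filterS2 df cdfe => x; split.
case/nbhs_ballP => d /= d0 dP.
have d20 : 0 < d / 2 by rewrite divr_gt0.
(* The added [1] keeps the threshold on [h] positive when [e] is zero. *)
have ne0 : 0 < `|e| + 1 by rewrite ltr_wpDl.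
exists (ball q (d / 2), [set h : R | 0 < h < d / 2 / (`|e| + 1)]) => /=.
  split; first exact: nbhsx_ballx.
  near=> h; apply/andP; split=> //.
  by near: h; apply: nbhs_right_lt; rewrite divr_gt0.
move=> [a h] /= [qa /andP[h0 hd]].
have inball t : 0 <= t <= h -> ball q d (t *: e + a).
  move=> /andP[t0 th]; rewrite -ball_normE /= opprD addrCA.
  rewrite (le_lt_trans (ler_normD _ _))// [ltRHS](splitr d).
  move: qa; rewrite -ball_normE /= => qa.
  rewrite ltrD// normrN normrZ ger0_norm//.
  rewrite (le_lt_trans (y := h * (`|e| + 1)))//.
    by rewrite ler_pM// lerDl.
  by rewrite -ltr_pdivlMr.
have drv t : 0 <= t <= h ->
    is_derive t 1 (fun s : R => f (s *: e + a)) ('D_e f (t *: e + a)).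
  by move=> th; apply: is_derive_on_line; have [] := dP _ (inball _ th).
have [|| c cab] := @MVT _ (fun s : R => f (s *: e + a))
    (fun s => 'D_e f (s *: e + a)) _ _ h0.
- by move=> x; rewrite in_itv/= => /andP[x0 xh]; apply: drv; rewrite !ltW.
- apply: derivable_within_continuous => x; rewrite in_itv /= => xh.
  by have [] := drv x xh.
rewrite /= scale0r add0r subr0 => ->.
move: cab; rewrite in_itv /= => /andP[/ltW c0 /ltW ch].
rewrite [h * _]mulrC -mulrBl normrM (gtr0_norm h0) ler_wpM2r ?ltW//.
have [_ ca] : derivable f (c *: e + a) e /\ `|'D_e f q - 'D_e f (c *: e + a)| < eps / 2.
  by apply/dP/inball; rewrite c0 ch.
have [_ aa] : derivable f (0 *: e + a) e /\ `|'D_e f q - 'D_e f (0 *: e + a)| < eps / 2.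
  by apply/dP/inball; rewrite lexx ltW.
move: aa; rewrite scale0r add0r => aa.
rewrite -(subrKA ('D_e f q)) [ltRHS](splitr eps) (le_lt_trans (ler_normD _ _))//.
by rewrite ltrD// distrC.
Unshelve. all: by end_near. Qed.

End DirectionalC1.

(** * Riemann sums of a divergence *)

Lemma compact_box {R : realType} (M : R) :
  compact ([set` `[- M, M]] `*` [set` `[- M, M]] : set (R * R)).
Proof. by apply: compact_setX; exact: segment_compact. Qed.

Section GridSum.
Context {R : realType} (M : R).
Implicit Types (f g : R * R -> R) (q : R * R) (K i j : nat) (a r x eps : R).

Definition step K : R := 2 * M / K%:R.
Definition node K i : R := - M + i%:R * step K.
(** A Riemann sum over the square of half-side [M] about the origin, sampled at lower-left corners,
    so that forward differences from all sampled nodes telescope. *)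
Definition gridsum K f : R :=
  step K ^+ 2 * \sum_(i < K) \sum_(j < K) f (node K i, node K j).

Lemma nodeS K i : node K i.+1 = node K i + step K.
Proof. by rewrite /node mulrSr mulrDl mul1r addrA. Qed.

Lemma node0 K : node K 0 = - M.
Proof. by rewrite /node mul0r addr0. Qed.

Lemma node_last K : (0 < K)%N -> node K K = M.
Proof.
move=> K0; have K0R : (K%:R : R) != 0 by rewrite pnatr_eq0 -lt0n.
by rewrite /node /step; field.
Qed.

Lemma sum_node_incr (g : R -> R) K : (0 < K)%N ->
  \sum_(i < K) (g (node K i.+1) - g (node K i)) = g M - g (- M).
Proof.
move=> K0.
rewrite -(big_mkord xpredT (fun i => g (node K i.+1) - g (node K i))).
by rewrite (telescope_sumr (fun i => g (node K i)))// node_last// node0.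
Qed.

Lemma le_gridsum K f g : (forall q, f q <= g q) -> gridsum K f <= gridsum K g.
Proof.
move=> fg; rewrite /gridsum ler_wpM2l ?sqr_ge0//.
by apply: ler_sum => i _; apply: ler_sum.
Qed.

Lemma gridsumD K f g : gridsum K (f + g) = gridsum K f + gridsum K g.
Proof.
rewrite /gridsum -mulrDr -big_split /=; congr (_ * _).
by apply: eq_bigr => i _; rewrite -big_split.
Qed.

Lemma gridsumZ K (c : R) f : gridsum K (c *: f) = c * gridsum K f.
Proof.
rewrite /gridsum mulrCA; congr (_ * _); rewrite mulr_sumr.
by apply: eq_bigr => i _; rewrite mulr_sumr.
Qed.

Lemma gridsum_sum K n (F : nat -> R * R -> R) :
  gridsum K (\sum_(k < n) F k) = \sum_(k < n) gridsum K (F k).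
Proof.
elim: n => [|n IH]; last by rewrite !big_ord_recr /= gridsumD IH.
rewrite !big_ord0 /gridsum big1 ?mulr0// => i _.
by rewrite big1.
Qed.

Hypothesis M0 : 0 < M.

Lemma step_gt0 K : (0 < K)%N -> 0 < step K.
Proof. by move=> K0; rewrite /step divr_gt0 ?mulr_gt0 ?ltr0n. Qed.

(** A clamp gains a full step across each cell inside its interval and nothing outside, so its
    telescoped increments count nodes. *)
Let clamp l u x : R := Num.max l (Num.min u x).

Let clampE l u x : l <= u ->
  [\/ x <= l /\ clamp l u x = l, l <= x <= u /\ clamp l u x = x |
      u <= x /\ clamp l u x = u].
Proof.
move=> lu; rewrite /clamp; case: (leP u x) => ux.
  by rewrite max_r//; apply: Or33.
by case: (leP l x) => lx; [apply: Or32|apply: Or31]; split=> //; lra.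
Qed.

(** The upper end of the clamp is moved up by one step, so that every node within [r] of [a]
    contributes a full step. The total gain is at most the length of the clamp interval. *)
Lemma node_count_le K a r : (0 < K)%N -> 0 < r ->
  step K * \sum_(i < K) (`|a - node K i| < r)%R%:R <= 2 * r + step K.
Proof.
move=> K0 r0; have h0 := step_gt0 K0.
rewrite mulr_sumr.
have lu : a - r <= a + r + step K by lra.
pose g := clamp (a - r) (a + r + step K).
apply: (@le_trans _ _ (\sum_(i < K) (g (node K i.+1) - g (node K i)))).
  apply: ler_sum => i _; rewrite nodeS /g.
  have := clampE (node K i) lu; have := clampE (node K i + step K) lu.
  case: (ltP `|a - node K i| r) => [|_] /=; rewrite ?mulr1 ?mulr0.
    by rewrite ltr_norml => /andP[? ?] [[? ->]|[? ->]|[? ->]] [[? ->]|[? ->]|[? ->]]; lra.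
  by move=> [[? ->]|[? ->]|[? ->]] [[? ->]|[? ->]|[? ->]]; lra.
rewrite sum_node_incr// /g; have := clampE M lu; have := clampE (- M) lu.
by move=> [[? ->]|[? ->]|[? ->]] [[? ->]|[? ->]|[? ->]]; lra.
Qed.

(** Here the lower end of the clamp is raised by one step, so that nodes at distance at least [r]
    contribute nothing. As the interval lies in [[- M, M]], the total gain is its full length. *)
Lemma node_count_ge K a r : (0 < K)%N -> step K <= 2 * r ->
  - M <= a - r -> a + r <= M ->
  2 * r - step K <= step K * \sum_(i < K) (`|a - node K i| < r)%R%:R.
Proof.
move=> K0 hr aM Ma; have h0 := step_gt0 K0.
rewrite mulr_sumr.
have lu : a - r + step K <= a + r by lra.
pose g := clamp (a - r + step K) (a + r).
apply: (@le_trans _ _ (\sum_(i < K) (g (node K i.+1) - g (node K i)))); last first.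
  apply: ler_sum => i _; rewrite nodeS /g.
  have := clampE (node K i) lu; have := clampE (node K i + step K) lu.
  case: (ltP `|a - node K i| r) => [_|] /=; rewrite ?mulr1 ?mulr0.
    by move=> [[? ->]|[? ->]|[? ->]] [[? ->]|[? ->]|[? ->]]; lra.
  rewrite leNgt ltr_norml negb_and -!leNgt => /orP[?|?];
    by move=> [[? ->]|[? ->]|[? ->]] [[? ->]|[? ->]|[? ->]]; lra.
rewrite sum_node_incr// /g; have := clampE M lu; have := clampE (- M) lu.
by move=> [[? ->]|[? ->]|[? ->]] [[? ->]|[? ->]|[? ->]]; lra.
Qed.

(** Balls of [R * R] are open squares for the maximum norm, so indicators factor and node counts
    multiply. *)
Lemma ball_prodE (c q : R * R) r :
  (\1_(ball c r) q : R) = (`|c.1 - q.1| < r)%R%:R * (`|c.2 - q.2| < r)%R%:R.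
Proof.
rewrite indicE -natrM mulnb; congr ((nat_of_bool _)%:R).
by apply/idP/idP; rewrite inE => /andP.
Qed.

Lemma gridsum_ball K (c : R * R) r :
  gridsum K \1_(ball c r) =
  (step K * \sum_(i < K) (`|c.1 - node K i| < r)%R%:R) *
  (step K * \sum_(i < K) (`|c.2 - node K i| < r)%R%:R).
Proof.
rewrite /gridsum expr2 [RHS]mulrACA; congr (_ * _).
rewrite mulr_suml; apply: eq_bigr => i _.
by rewrite mulr_sumr; apply: eq_bigr => j _; rewrite ball_prodE.
Qed.

Lemma gridsum_ball_le K (c : R * R) r : (0 < K)%N -> 0 < r ->
  gridsum K \1_(ball c r) <= (2 * r + step K) ^+ 2.
Proof.
move=> K0 r0; rewrite gridsum_ball expr2.
have h0 := step_gt0 K0.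
by apply: ler_pM; rewrite ?node_count_le//; apply: mulr_ge0; rewrite ?(ltW h0)//;
  apply: sumr_ge0.
Qed.

Lemma gridsum_ball_ge K (c : R * R) r : (0 < K)%N -> step K <= 2 * r ->
  `|c.1| + r <= M -> `|c.2| + r <= M ->
  (2 * r - step K) ^+ 2 <= gridsum K \1_(ball c r).
Proof.
move=> K0 hr c1 c2; rewrite gridsum_ball expr2.
have [c1M Mc1] : - M <= c.1 - r /\ c.1 + r <= M.
  by have := ler_norm c.1; have := ler_norm (- c.1); rewrite normrN; split; lra.
have [c2M Mc2] : - M <= c.2 - r /\ c.2 + r <= M.
  by have := ler_norm c.2; have := ler_norm (- c.2); rewrite normrN; split; lra.
by apply: ler_pM; rewrite ?node_count_ge// subr_ge0.
Qed.

Lemma step_cvg0 (d : R) : 0 < d -> \forall K \near \oo, (0 < K)%N /\ step K < d.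
Proof.
move=> d0; near=> K.
have K0 : (0 < K)%N by near: K; exact: nbhs_infty_gt.
split=> //; have : 2 * M / d < K%:R by near: K; exact: nbhs_infty_gtr.
by rewrite ltr_pdivrMr// /step ltr_pdivrMr ?ltr0n// [K%:R * _]mulrC.
Unshelve. all: by end_near. Qed.

(** Compactness of the square turns the local estimates into a single threshold on [h]. *)
Lemma C1at_uniform (e : R * R) (G : R * R -> R) : (forall q, C1at e G q) ->
  forall eps, 0 < eps -> \forall h \near 0^'+,
    forall a : R * R, `|a.1| <= M -> `|a.2| <= M ->
    `|G (h *: e + a) - G a - h * 'D_e G a| <= eps * h.
Proof.
move=> CG eps e0.
have /compact_near_coveringP := @compact_box _ M.
move=> /(_ R 0^'+ (fun (h : R) (a : R * R) => `|G (h *: e + a) - G a - h * 'D_e G a| <= eps * h) _).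
move=> H.
have {H} := H (fun q _ => C1at_difference_quotient (CG q) e0).
apply: filterS => h H a a1 a2; apply: H; split => /=;
  by rewrite in_itv /= -ler_norml.
Qed.

Lemma node_norm_le K i : (0 < K)%N -> (i <= K)%N -> `|node K i| <= M.
Proof.
move=> K0 iK; have h0 := step_gt0 K0; rewrite ler_norml /node.
have iKh : i%:R * step K <= K%:R * step K by rewrite ler_wpM2r ?ler_nat// ltW.
have ih : 0 <= i%:R * step K by rewrite mulr_ge0// ltW.
have := node_last K0; rewrite /node; lra.
Qed.

Lemma norm_double_sum_le K (F : nat -> nat -> R) b :
  (forall i j : 'I_K, `|F i j| <= b) ->
  `|\sum_(i < K) \sum_(j < K) F i j| <= K%:R ^+ 2 * b.
Proof.
move=> Fb; apply: (le_trans (ler_norm_sum _ _ _)).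
apply: (@le_trans _ _ (\sum_(i < K) \sum_(j < K) b)).
  apply: ler_sum => i _; apply: (le_trans (ler_norm_sum _ _ _)).
  by apply: ler_sum.
by rewrite !sumr_const !card_ord -mulrnA -[leLHS]mulr_natl natrM expr2.
Qed.

(* Summing difference quotients over the grid telescopes to boundary values. *)
Lemma gridsum_div_cvg0 (G1 G2 : R * R -> R) :
  (forall q, C1at (1, 0) G1 q) -> (forall q, C1at (0, 1) G2 q) ->
  (forall q, ~ ball 0 M q -> G1 q = 0 /\ G2 q = 0) ->
  forall eps, 0 < eps -> \forall K \near \oo,
    `|gridsum K ('D_(1, 0) G1 + 'D_(0, 1) G2)| <= eps.
Proof.
move=> C1 C2 Z eps e0.
have [Z1 Z2] : (forall q, ~ ball 0 M q -> G1 q = 0) /\ (forall q, ~ ball 0 M q -> G2 q = 0).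
  by split=> q /Z [].
(* With [h] the step, the [K ^ 2] cells give a total error of [2 * eps' * (K * h) ^ 2], and
   [K * h = 2 * M]. *)
pose eps' := eps / (8 * M ^+ 2).
have e'0 : 0 < eps' by rewrite divr_gt0// mulr_gt0// exprn_gt0.
have [d1 /= d10 U1] := C1at_uniform C1 e'0.
have [d2 /= d20 U2] := C1at_uniform C2 e'0.
near=> K.
have [K0 hd1] : (0 < K)%N /\ step K < d1 by near: K; exact: step_cvg0.
have [_ hd2] : (0 < K)%N /\ step K < d2 by near: K; exact: step_cvg0.
have h0 := step_gt0 K0; set h := step K in h0 hd1 hd2.
have {U1} U1 (a : R * R) : `|a.1| <= M -> `|a.2| <= M ->
    `|G1 (h *: (1, 0) + a) - G1 a - h * 'D_(1, 0) G1 a| <= eps' * h.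
  by apply: U1 => //=; rewrite sub0r normrN gtr0_norm.
have {U2} U2 (a : R * R) : `|a.1| <= M -> `|a.2| <= M ->
    `|G2 (h *: (0, 1) + a) - G2 a - h * 'D_(0, 1) G2 a| <= eps' * h.
  by apply: U2 => //=; rewrite sub0r normrN gtr0_norm.
(* The square is open, so its edges, where the telescoped sums end, lie outside it, and [G1] and
   [G2] vanish there. *)
have out1 y (s : R) : `|s| = M -> ~ ball (0 : R * R) M (s, y).
  by move=> sM [/=]; rewrite -ball_normE /= sub0r normrN sM ltxx.
have out2 x (s : R) : `|s| = M -> ~ ball (0 : R * R) M (x, s).
  by move=> sM [/= _]; rewrite -ball_normE /= sub0r normrN sM ltxx.
have T1 j : \sum_(i < K) (G1 (node K i.+1, node K j) - G1 (node K i, node K j)) = 0.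
  rewrite (sum_node_incr (fun x => G1 (x, node K j)))//.
  by rewrite !Z1 ?subrr//; apply: out1; rewrite ?normrN gtr0_norm.
have T2 i : \sum_(j < K) (G2 (node K i, node K j.+1) - G2 (node K i, node K j)) = 0.
  rewrite (sum_node_incr (fun y => G2 (node K i, y)))//.
  by rewrite !Z2 ?subrr//; apply: out2; rewrite ?normrN gtr0_norm.
pose D i j := 'D_(1, 0) G1 (node K i, node K j) + 'D_(0, 1) G2 (node K i, node K j).
pose E i j := G1 (node K i.+1, node K j) - G1 (node K i, node K j) +
  (G2 (node K i, node K j.+1) - G2 (node K i, node K j)).
have E0 : \sum_(i < K) \sum_(j < K) E i j = 0.
  under eq_bigr do rewrite big_split /=.
  rewrite big_split /= exchange_big /=.
  by under eq_bigr do rewrite T1; under [X in _ + X]eq_bigr do rewrite T2; rewrite !big1// addr0.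
(* As the differences [E] sum to [0], only the discrepancy between [E] and [h * D] remains. *)
have -> : gridsum K ('D_(1, 0) G1 + 'D_(0, 1) G2) =
    - h * \sum_(i < K) \sum_(j < K) (E i j - h * D i j).
  rewrite /gridsum -/h.
  under [in RHS]eq_bigr do rewrite sumrB.
  rewrite sumrB E0 sub0r mulrNN; under [in RHS]eq_bigr do rewrite -mulr_sumr.
  by rewrite -mulr_sumr mulrA expr2.
rewrite normrM normrN (gtr0_norm h0).
have Eb (i j : 'I_K) : `|E i j - h * D i j| <= 2 * eps' * h.
  have iM := node_norm_le K0 (ltnW (ltn_ord i)).
  have jM := node_norm_le K0 (ltnW (ltn_ord j)).
  have := U1 (node K i, node K j) iM jM; have := U2 (node K i, node K j) iM jM.
  have -> : h *: (1, 0) + (node K i, node K j) = (node K i.+1, node K j) :> R * R.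
    by apply: injective_projections => /=; rewrite ?nodeS -?/h ?scaler0 ?[_ *: 1]mulr1 ?add0r// addrC.
  have -> : h *: (0, 1) + (node K i, node K j) = (node K i, node K j.+1) :> R * R.
    by apply: injective_projections => /=; rewrite ?nodeS -?/h ?scaler0 ?[_ *: 1]mulr1 ?add0r// addrC.
  rewrite /E /D => H2 H1.
  rewrite mulrDr opprD addrACA (le_trans (ler_normD _ _))//.
  by rewrite -mulrA mulr_natl mulr2n lerD.
apply: (@le_trans _ _ (h * (K%:R ^+ 2 * (2 * eps' * h)))).
  by rewrite ler_pM2l//; exact: (norm_double_sum_le (F := fun i j => E i j - h * D i j) Eb).
have hK : K%:R * h = 2 * M.
  by rewrite /h /step mulrC divfK// pnatr_eq0 -lt0n.
have -> : h * (K%:R ^+ 2 * (2 * eps' * h)) = 2 * eps' * (K%:R * h) ^+ 2 by ring.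
rewrite hK /eps' (_ : 2 * _ * _ = eps)//.
by field; rewrite gt_eqF.
Unshelve. all: by end_near. Qed.

End GridSum.

(** * Cutoff functions *)

Section Cutoff.
Context {R : realType}.
Implicit Types (s t r : R) (c q e : R * R).

(** Squaring removes the corner of the positive part; all cutoffs are composed from this [C^1]
    function. *)
Definition pos2 s : R := Num.max s 0 ^+ 2.

Lemma is_derive_pos2 s : is_derive s 1 pos2 (2 * Num.max s 0).
Proof.
have [s0|s0|->] := ltgtP s 0.
- rewrite mulr0; apply: (near_eq_is_derive (f := cst 0)).
  near=> t; rewrite /pos2 max_r ?expr0n//.
  by apply: ltW; near: t; exact: lt_nbhsl.
- apply: (near_eq_is_derive (f := fun t => t ^+ 2)).
    near=> t; rewrite /pos2 max_l//.
    by apply: ltW; near: t; exact: lt_nbhsr.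
  by apply: is_derive_eq; rewrite [s%:A]mulr1 mulr_natl mulr2n.
- rewrite mulr0.
  (* At the junction [0] the difference quotient is bounded by [|h|]. *)
  suff cv : (fun h : R => h^-1 *: ((pos2 \o shift 0) (h *: 1) - pos2 0)) @ 0^' --> (0 : R).
    by split; [apply/cvg_ex; exists 0|exact: cvg_lim].
  apply/cvgr0Pnorm_lt => eps eps0; near=> h.
  have h0 : h != 0 by near: h; exact: nbhs_dnbhs_neq.
  have he : `|h| < eps by near: h; apply: dnbhs0_lt.
  rewrite /= /shift /pos2 addr0 [_ *: 1]mulr1 maxxx expr0n subr0.
  apply: le_lt_trans he; rewrite normrM normfV ler_pdivrMl ?normr_gt0//.
  rewrite ger0_norm ?sqr_ge0// -expr2 lerXn2r ?nnegrE// ?le_max ?lexx ?orbT//.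
  by rewrite ge_max ler_norm normr_ge0.
Unshelve. all: by end_near. Qed.

Lemma continuous_pos : continuous (fun s : R => Num.max s 0).
Proof.
move=> s; have -> : (fun s : R => Num.max s 0) = (fun s : R => (s + 0 + `|s - 0|) / 2).
  by apply/funext => t; rewrite maxr_absE.
apply: cvgM; last exact: cvg_cst.
apply: cvgD; first by apply: cvgD; [exact: cvg_id|exact: cvg_cst].
by apply: cvg_norm; apply: cvgB; [exact: cvg_id|exact: cvg_cst].
Qed.

(* A nondecreasing [C^1] step from [0] on the negative half-line to [1] on [[1, +oo[]. *)
Definition rise s : R := 1 - pos2 (1 - pos2 s).
Definition drise s : R := 4 * Num.max (1 - pos2 s) 0 * Num.max s 0.

Lemma is_derive_rise s : is_derive s 1 rise (drise s).
Proof.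
have d1 : is_derive s 1 (fun t => 1 - pos2 t) (- (2 * Num.max s 0)).
  have dp := is_derive_pos2 s.
  by apply: is_derive_eq (is_deriveB (is_derive_cst (1 : R) s 1) dp) _; rewrite sub0r.
have d2 := @is_derive1_comp _ pos2 (fun t => 1 - pos2 t) _ _ _
  (is_derive_pos2 (1 - pos2 s)) d1.
have -> : rise = cst 1 - (pos2 \o (fun t => 1 - pos2 t)) by [].
apply: is_derive_eq (is_deriveB (is_derive_cst (1 : R) s 1) d2) _.
by rewrite sub0r /drise; ring.
Qed.

Lemma continuous_drise : continuous drise.
Proof.
move=> s; have cp : {for s, continuous (fun t => 1 - pos2 t)}.
  apply: cvgB; first exact: cvg_cst.
  by apply: cvgM; exact: continuous_pos.
apply: cvgM; last exact: continuous_pos.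
apply: cvgM; first exact: cvg_cst.
apply: (@continuous_comp _ _ _ (fun t => 1 - pos2 t) (fun t => Num.max t 0) _
  cp); exact: continuous_pos.
Qed.

Lemma pos2_ge0 s : 0 <= pos2 s. Proof. exact: sqr_ge0. Qed.

Lemma pos2_eq0 s : s <= 0 -> pos2 s = 0.
Proof. by move=> s0; rewrite /pos2 max_r// expr0n. Qed.

Lemma pos2_le1 s : s <= 1 -> pos2 s <= 1.
Proof.
by move=> s1; rewrite /pos2 exprn_ile1// ?le_max ?lexx ?orbT// ge_max s1 ler01.
Qed.

Lemma pos2_ge1 s : 1 <= s -> 1 <= pos2 s.
Proof. by move=> s1; rewrite /pos2 exprn_ege1// le_max s1. Qed.

Lemma rise_ge0 s : 0 <= rise s.
Proof. by rewrite subr_ge0 pos2_le1// gerBl pos2_ge0. Qed.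

Lemma rise_le1 s : rise s <= 1.
Proof. by rewrite gerBl pos2_ge0. Qed.

Lemma rise_eq0 s : s <= 0 -> rise s = 0.
Proof.
by move=> s0; rewrite /rise (pos2_eq0 s0) subr0 /pos2 max_l// expr1n subrr.
Qed.

Lemma rise_eq1 s : 1 <= s -> rise s = 1.
Proof. by move=> s1; rewrite /rise (@pos2_eq0 (1 - _)) ?subr0// subr_le0 pos2_ge1. Qed.

Lemma drise_ge0 s : 0 <= drise s.
Proof. by rewrite !mulr_ge0// le_max lexx orbT. Qed.

Lemma drise_gt0 s : 0 < s < 1 -> 0 < drise s.
Proof.
move=> /andP[s0 s1]; rewrite /drise /pos2 (max_l (ltW s0)) !mulr_gt0// lt_max subr_gt0.
by rewrite exprn_ilt1// ltW.
Qed.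

Lemma drise_eq0 s : 1 <= s -> drise s = 0.
Proof.
by move=> s1; rewrite /drise max_r ?mulr0 ?mul0r// subr_le0 pos2_ge1.
Qed.

Lemma drise_le4 s : drise s <= 4.
Proof.
have [s1|/ltW s1] := lerP 1 s; first by rewrite drise_eq0.
rewrite /drise -mulrA ger_pMr// mulr_ile1// ?le_max ?lexx ?orbT//.
  by rewrite ge_max ler01 gerBl pos2_ge0.
by rewrite ge_max s1 ler01.
Qed.

(** A plateau, [1] for [|t| <= 1] and [0] for [|t| >= 2]; using [t ^+ 2] avoids the corner of the
    absolute value. *)
Definition bump t : R := 1 - rise (t ^+ 2 - 1).
Definition dbump t : R := - (drise (t ^+ 2 - 1) * (2 * t)).

Lemma is_derive_bump t : is_derive t 1 bump (dbump t).
Proof.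
have d1 : is_derive t 1 (fun s : R => s ^+ 2 - 1) (2 * t).
  by apply: is_derive_eq; rewrite subr0 [t%:A]mulr1 mulr_natl mulr2n.
have d2 := @is_derive1_comp _ rise (fun s => s ^+ 2 - 1) _ _ _
  (is_derive_rise (t ^+ 2 - 1)) d1.
have -> : bump = cst 1 - (rise \o (fun s => s ^+ 2 - 1)) by [].
apply: is_derive_eq (is_deriveB (is_derive_cst (1 : R) t 1) d2) _.
by rewrite sub0r.
Qed.

Lemma continuous_dbump : continuous dbump.
Proof.
move=> t; apply: cvgN; apply: cvgM; last by apply: cvgM; [exact: cvg_cst|exact: cvg_id].
have c1 : {for t, continuous (fun s : R => s ^+ 2 - 1)}.
  apply: cvgB; last exact: cvg_cst.
  exact: exprn_continuous.
apply: (@continuous_comp _ _ _ (fun t => t ^+ 2 - 1) drise _ c1); exact: continuous_drise.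
Qed.

Lemma bump_ge0 t : 0 <= bump t. Proof. by rewrite subr_ge0 rise_le1. Qed.

Lemma bump_le1 t : bump t <= 1. Proof. by rewrite gerBl rise_ge0. Qed.

Lemma bump_eq1 t : `|t| <= 1 -> bump t = 1.
Proof.
move=> t1; rewrite /bump rise_eq0 ?subr0// subr_le0 -real_normK ?num_real//.
exact: exprn_ile1.
Qed.

Let sqr_ge2 t : 2 <= `|t| -> 1 <= t ^+ 2 - 1.
Proof. by move=> t2; rewrite -real_normK ?num_real//; nra. Qed.

Lemma bump_eq0 t : 2 <= `|t| -> bump t = 0.
Proof. by move=> /sqr_ge2 t2; rewrite /bump rise_eq1 ?subrr. Qed.

Lemma dbump_eq0 t : 2 <= `|t| -> dbump t = 0.
Proof. by move=> /sqr_ge2 t2; rewrite /dbump drise_eq0 ?mul0r ?oppr0. Qed.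

(** Where [|t| < 2], the factor [drise] is at most [4] and [|2 * t|] is at most [4]. *)
Lemma dbump_le16 t : `|dbump t| <= 16.
Proof.
have [/dbump_eq0 ->|t2] := lerP 2 `|t|; first by rewrite normr0.
rewrite normrN normrM (ger0_norm (drise_ge0 _)) normrM (@ger0_norm _ 2)//.
have := drise_le4 (t ^+ 2 - 1); have := drise_ge0 (t ^+ 2 - 1).
have := normr_ge0 t; nra.
Qed.
End Cutoff.

(** * Cutoffs vanishing on finitely many squares *)

Section SquareCutoff.
Context {R : realType}.
Implicit Types (c q e a : R * R) (r d : R).

Lemma is_derive_affine e (f : R * R -> R) a d :
  (forall h : R, f (h *: e + a) = h * d + f a) -> is_derive a e f d.
Proof.
move=> fE.
suff cv : (fun h : R => h^-1 *: ((f \o shift a) (h *: e) - f a)) @ 0^' --> d.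
  by split; [apply/cvg_ex; exists d|exact: cvg_lim].
apply: cvg_near_cst; near=> h.
have h0 : h != 0 by near: h; exact: nbhs_dnbhs_neq.
rewrite /= /shift fE addrK; exact: mulKf.
Unshelve. all: by end_near. Qed.

Lemma C1at_fst e q : C1at e (fun p : R * R => p.1) q.
Proof.
apply: (@C1at_is_derive _ _ _ (cst e.1)); last 2 first.
- exact: cvg_fst.
- exact: cvg_cst.
by near=> x; apply: is_derive_affine.
Unshelve. all: by end_near. Qed.

Lemma C1at_snd e q : C1at e (fun p : R * R => p.2) q.
Proof.
apply: (@C1at_is_derive _ _ _ (cst e.2)); last 2 first.
- exact: cvg_snd.
- exact: cvg_cst.
by near=> x; apply: is_derive_affine.
Unshelve. all: by end_near. Qed.

Lemma ball_prodP c q r : ball c r q <-> `|c.1 - q.1| < r /\ `|c.2 - q.2| < r.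
Proof. by []. Qed.

Let coord1 c r : R * R -> R := fun q => (q.1 - c.1) / r.
Let coord2 c r : R * R -> R := fun q => (q.2 - c.2) / r.

Let is_derive_coord1 e c r q : is_derive q e (coord1 c r) (e.1 / r).
Proof. by apply: is_derive_affine => h; rewrite mulrA -mulrDl addrA. Qed.

Let is_derive_coord2 e c r q : is_derive q e (coord2 c r) (e.2 / r).
Proof. by apply: is_derive_affine => h; rewrite mulrA -mulrDl addrA. Qed.

Lemma C1at_bump e (f : R * R -> R) q : C1at e f q -> C1at e (bump \o f) q.
Proof.
move=> cf; apply: (C1at_comp cf (dphi := dbump)); last exact: continuous_dbump.
by near=> s; exact: is_derive_bump.
Unshelve. all: by end_near. Qed.

(** The product of one-variable plateaus fits the square shape of the balls: the cutoff is [0] on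
    [ball c r] and [1] off [ball c (2 * r)]. *)
Definition square_cutoff c r : R * R -> R :=
  cst 1 - (bump \o coord1 c r) * (bump \o coord2 c r).

Lemma C1at_square_cutoff e c r q : C1at e (square_cutoff c r) q.
Proof.
apply: C1atB; first exact: C1at_cst.
apply: C1atM; apply: C1at_bump; (apply: C1atM; last exact: C1at_cst);
  (apply: C1atB; last exact: C1at_cst); [exact: C1at_fst|exact: C1at_snd].
Qed.

Lemma square_cutoffE c r q :
  square_cutoff c r q = 1 - bump ((q.1 - c.1) / r) * bump ((q.2 - c.2) / r).
Proof. by []. Qed.

Lemma square_cutoff_ge0 c r q : 0 <= square_cutoff c r q.
Proof. by rewrite square_cutoffE subr_ge0 mulr_ile1 ?bump_ge0 ?bump_le1. Qed.

Lemma square_cutoff_le1 c r q : square_cutoff c r q <= 1.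
Proof. by rewrite square_cutoffE gerBl mulr_ge0 ?bump_ge0. Qed.

Lemma square_cutoff_eq0 c r q : 0 < r -> ball c r q -> square_cutoff c r q = 0.
Proof.
move=> r0 [/= q1 q2]; rewrite square_cutoffE !bump_eq1 ?mulr1 ?subrr//;
  by rewrite normrM normfV (gtr0_norm r0) ler_pdivrMr// mul1r distrC ltW.
Qed.

Let outside c r q : 0 < r -> ~ ball c (2 * r) q ->
  2 <= `|(q.1 - c.1) / r| \/ 2 <= `|(q.2 - c.2) / r|.
Proof.
move=> r0; rewrite ball_prodP => /not_andP qB.
by case: qB => /negP; rewrite -leNgt => qB; [left|right];
  rewrite normrM normfV (gtr0_norm r0) ler_pdivlMr// distrC.
Qed.

Lemma square_cutoff_eq1 c r q : 0 < r -> ~ ball c (2 * r) q -> square_cutoff c r q = 1.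
Proof.
move=> r0 /(outside r0) [] q2; rewrite square_cutoffE.
  by rewrite [X in X * _]bump_eq0// mul0r subr0.
by rewrite [X in _ * X]bump_eq0// mulr0 subr0.
Qed.

Lemma square_cutoff_ge c r q : 0 < r -> 1 - \1_(ball c (2 * r)) q <= square_cutoff c r q.
Proof.
move=> r0; rewrite indicE; have [|qB] := boolP (q \in _).
  by rewrite subrr square_cutoff_ge0.
by rewrite subr0 square_cutoff_eq1// => qB'; move/negP: qB; apply; rewrite inE.
Qed.

(** Each of the two terms of the product rule is at most [16 / r]. Off the doubled square some
    rescaled coordinate has size at least [2], where [bump] and [dbump] vanish together, which kills
    both terms. *)
Lemma derive_square_cutoff_le e c r q : 0 < r -> `|e.1| <= 1 -> `|e.2| <= 1 ->
  `|'D_e (square_cutoff c r) q| <= 32 / r * \1_(ball c (2 * r)) q.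
Proof.
move=> r0 e1 e2.
have d1 : is_derive q e (bump \o coord1 c r) (dbump ((q.1 - c.1) / r) * (e.1 / r)).
  have dc := is_derive_coord1 e c r q.
  by rewrite -(derive_val (is_derive := dc)); apply: is_derive_comp_dir;
    [exact: ex_derive|exact: is_derive_bump].
have d2 : is_derive q e (bump \o coord2 c r) (dbump ((q.2 - c.2) / r) * (e.2 / r)).
  have dc := is_derive_coord2 e c r q.
  by rewrite -(derive_val (is_derive := dc)); apply: is_derive_comp_dir;
    [exact: ex_derive|exact: is_derive_bump].
have dc := is_deriveB (is_derive_cst (1 : R) q e) (is_deriveM d1 d2).
rewrite /square_cutoff (derive_val (is_derive := dc)) sub0r normrN.
rewrite /coord1 /coord2 /=.
set X := (q.1 - c.1) / r; set Y := (q.2 - c.2) / r.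
have Hx : `|e.1 / r| <= r^-1.
  by rewrite normrM normfV (gtr0_norm r0) ler_piMl// invr_ge0 ltW.
have Hy : `|e.2 / r| <= r^-1.
  by rewrite normrM normfV (gtr0_norm r0) ler_piMl// invr_ge0 ltW.
rewrite indicE; have [_|qB] := boolP (q \in _); last first.
  have {}qB : ~ ball c (2 * r) q by move=> qB'; move/negP: qB; apply; rewrite inE.
  have [q2|q2] := outside r0 qB.
    by rewrite -/X in q2; rewrite (bump_eq0 q2) (dbump_eq0 q2) !mul0r scaler0 scale0r addr0 normr0 mulr0.
  by rewrite -/Y in q2; rewrite (bump_eq0 q2) (dbump_eq0 q2) !mul0r scaler0 scale0r addr0 normr0 mulr0.
rewrite mulr1 (le_trans (ler_normD _ _))//.
have key (b d x : R) : 0 <= b <= 1 -> `|d| <= 16 -> `|x| <= r^-1 ->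
    `|b * (d * x)| <= 16 / r.
  move=> /andP[b0 b1] d16 xr; rewrite normrM (ger0_norm b0).
  by rewrite (le_trans (ler_piMl _ b1))// normrM ler_pM.
have -> : 32 / r = 16 / r + 16 / r by ring.
by apply: lerD; apply: key; rewrite ?bump_ge0 ?bump_le1 ?dbump_le16.
Qed.

(** The product of the [n] square cutoffs serves: since all factors lie in [[0, 1]], both the
    deficits from [1] and the derivative bounds add up. *)
Lemma cutoff_squares (n : nat) (c : nat -> R * R) (r : nat -> R) :
  (forall i, 0 < r i) -> exists eta : R * R -> R,
  [/\ forall e q, C1at e eta q,
      forall q, 0 <= eta q <= 1,
      forall i q, (i < n)%N -> ball (c i) (r i) q -> eta q = 0,
      forall q, 1 - \sum_(i < n) \1_(ball (c i) (2 * r i)) q <= eta q &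
      forall e q, `|e.1| <= 1 -> `|e.2| <= 1 ->
        `|'D_e eta q| <= \sum_(i < n) 32 / r i * \1_(ball (c i) (2 * r i)) q].
Proof.
move=> r0; elim: n => [|n [eta [C1 eta01 eta0 eta1 deta]]].
  exists (cst 1); split => //.
  - by move=> e q; exact: C1at_cst.
  - by move=> q; rewrite ler01 lexx.
  - by move=> q; rewrite big_ord0 subr0.
  - by move=> e q _ _; rewrite derive_cst normr0 big_ord0.
pose k := square_cutoff (c n) (r n).
have k0 q : 0 <= k q := square_cutoff_ge0 _ _ _.
have k1 q : k q <= 1 := square_cutoff_le1 _ _ _.
have ekE q : (eta * k) q = eta q * k q by [].
exists (eta * k); split.
- by move=> e q; apply: C1atM => //; exact: C1at_square_cutoff.
- move=> q; have /andP[? ?] := eta01 q.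
  by rewrite ekE mulr_ge0//= mulr_ile1.
- move=> i q; rewrite ltnS leq_eqVlt => /predU1P[->|iltn] qB.
    by rewrite ekE [k q](square_cutoff_eq0 (r0 n) qB) mulr0.
  by rewrite ekE (eta0 _ _ iltn qB) mul0r.
- move=> q; rewrite big_ord_recr /= ekE.
  (* From [(1 - eta) * (1 - k) >= 0] one gets [eta * k >= eta + k - 1]. *)
  have := square_cutoff_ge (c n) q (r0 n); rewrite -/(k q).
  have := eta1 q; have /andP[] := eta01 q; have := k0 q; have := k1 q.
  nra.
move=> e q e1 e2; rewrite big_ord_recr /= deriveM; last 2 first.
- exact: C1at_derivable.
- by apply: C1at_derivable; exact: C1at_square_cutoff.
have /andP[h0 h1] := eta01 q.
rewrite [X in `|X|]addrC (le_trans (ler_normD _ _))// lerD//.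
  by rewrite normrZ (ger0_norm (k0 q)) (le_trans (ler_piMl _ (k1 q)))// deta.
rewrite normrZ (ger0_norm h0) (le_trans (ler_piMl _ h1))//.
exact: derive_square_cutoff_le.
Qed.

End SquareCutoff.

(** * Covers of sets of vanishing Hausdorff measure *)

Lemma coord_le_edist {R : realType} (p q : R * R) :
  `|p.1 - q.1| <= Defs.edist p q /\ `|p.2 - q.2| <= Defs.edist p q.
Proof.
by split; rewrite -sqrtr_sqr ler_wsqrtr// ?lerDl ?lerDr sqr_ge0.
Qed.

Lemma sum_halves_le {R : realType} n (t : R) : 0 <= t ->
  \sum_(i < n) t / 2 ^+ i.+1 <= t.
Proof.
move=> t0; suff -> : \sum_(i < n) t / 2 ^+ i.+1 = t - t / 2 ^+ n.
  by rewrite gerBl divr_ge0.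
elim: n => [|n IH]; first by rewrite big_ord0 expr0 divr1 subrr.
rewrite big_ord_recr /= IH exprS; field.
by rewrite expf_neq0.
Qed.

(** A countable cover with small total diameter is fattened to open squares centred at points of its
    pieces; compactness keeps finitely many of them. *)
Lemma hausdorff1_eq0_cover {R : realType} (A : set (R * R)) (tau : R) :
  compact A -> hausdorff1 A = 0%E -> 0 < tau ->
  exists n (c : nat -> R * R) (r : nat -> R),
  [/\ forall i, 0 < r i,
      forall q, A q -> exists2 i, (i < n)%N & ball (c i) (r i) q &
      \sum_(i < n) r i <= tau].
Proof.
move=> cA HA tau0.
have t20 : 0 < tau / 2 by rewrite divr_gt0.
(* The scale [1] is arbitrary and makes all diameters finite. Half of [tau] goes to the diameters,
   half to the padding of the radii. *)
have : (hausdorff1_delta 1 A < (tau / 2)%:E)%E.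
  apply: (@le_lt_trans _ _ (hausdorff1 A)); last by rewrite HA lte_fin.
  by apply: ereal_sup_ubound; exists 1 => //=.
move=> /ereal_inf_lt [_ [C [AC C1] <-] SC].
have dge0 i : (0 <= ediam (C i))%E by apply: ereal_sup_ubound; left.
have dfin i : ediam (C i) \is a fin_num.
  by rewrite ge0_fin_numE// (le_lt_trans (C1 i))// ltry.
(* The default centre [0] occurs for empty pieces, whose inclusion in a ball is trivial. *)
pose c i := xget (0 : R * R) (C i).
(* The geometric padding makes the radius positive and puts the piece inside the open ball. *)
pose r i := fine (ediam (C i)) + tau / 2 / 2 ^+ i.+1.
have r0 i : 0 < r i.
  by rewrite /r ltr_wpDl ?fine_ge0// !divr_gt0// exprn_gt0.
have Cball i : C i `<=` ball (c i) (r i).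
  move=> q Ciq; have Cc : C i (c i) by apply: xgetPex; exists q.
  have dq : Defs.edist (c i) q < r i.
    apply: (@le_lt_trans _ _ (fine (ediam (C i)))).
      rewrite -lee_fin fineK//; apply: ereal_sup_ubound; right.
      by exists (c i, q).
    by rewrite /r ltrDl !divr_gt0// exprn_gt0.
  have [d1 d2] := coord_le_edist (c i) q.
  by split; apply: le_lt_trans dq.
(* Lying in one of the first [n] balls is monotone in [n], so the finite subcover is obtained as a
   single large [n]. *)
have /compact_near_coveringP := cA.
move=> /(_ nat \oo (fun n q => exists2 i, (i < n)%N & ball (c i) (r i) q) _) [].
  move=> q /AC [i _ /Cball iq].
  exists (ball (c i) (r i), [set n | (i < n)%N]) => /=; last first.
    by move=> [q' m] /= [? ?]; exists i.
  split; last by exists i.+1.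
  have ob : open (ball (c i) (r i)) by exact: ball_open.
  exact: (open_nbhs_nbhs (conj ob iq)).
move=> n _ /(_ n (leqnn n)) An; exists n, c, r; split=> //.
rewrite big_split /= [leRHS]splitr; apply: lerD; last exact: sum_halves_le (ltW t20).
rewrite -lee_fin (le_trans _ (ltW SC))//.
rewrite -sumEFin; under eq_bigr do rewrite fineK//.
rewrite -(big_mkord xpredT (fun i => ediam (C i))).
exact: nneseries_lim_ge.
Qed.

(** * The normalized slope field *)

Section Partials.
Context {R : realType}.
Implicit Types (f : R * R -> R) (p e : R * R).

Let shift_x (h : R) p : h *: (1, 0) + p = (h + p.1, p.2).
Proof. by apply: injective_projections; rewrite /= ?[h *: 1]mulr1 ?scaler0 ?add0r. Qed.

Let shift_y (h : R) p : h *: (0, 1) + p = (p.1, h + p.2).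
Proof. by apply: injective_projections; rewrite /= ?[h *: 1]mulr1 ?scaler0 ?add0r. Qed.

Lemma partial_xE f : partial_x f = 'D_(1, 0) f.
Proof.
apply/funext => p; rewrite /partial_x /derive1 /derive.
set g := (X in lim (X @ _)).
have -> // : g = (fun h : R => h^-1 *: ((f \o shift p) (h *: (1, 0)) - f p)).
by apply/funext => h; rewrite /g /= /shift shift_x -(surjective_pairing p).
Qed.

Lemma partial_yE f : partial_y f = 'D_(0, 1) f.
Proof.
apply/funext => p; rewrite /partial_y /derive1 /derive.
set g := (X in lim (X @ _)).
have -> // : g = (fun h : R => h^-1 *: ((f \o shift p) (h *: (0, 1)) - f p)).
by apply/funext => h; rewrite /g /= /shift shift_y -(surjective_pairing p).
Qed.

Lemma has_partialsE f p :
  has_partials f p <-> derivable f p (1, 0) /\ derivable f p (0, 1).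
Proof.
rewrite /has_partials /derivable.
set g1 := (X in cvg (X @ _) /\ _); set g2 := (X in _ /\ cvg (X @ _)).
have -> : g1 = (fun h : R => h^-1 *: ((f \o shift p) (h *: (1, 0)) - f p)).
  by apply/funext => h; rewrite /g1 /= /shift shift_x [_ *: 1]mulr1 -(surjective_pairing p).
have -> // : g2 = (fun h : R => h^-1 *: ((f \o shift p) (h *: (0, 1)) - f p)).
by apply/funext => h; rewrite /g2 /= /shift shift_y [_ *: 1]mulr1 -(surjective_pairing p).
Qed.

Lemma C2_on_C1at (A : set (R * R)) f p e : C2_on A f -> A p ->
  e = (1, 0) \/ e = (0, 1) ->
  [/\ C1at e f p, C1at e (partial_x f) p & C1at e (partial_y f) p].
Proof.
move=> [U [Uo AU Uf]] /AU Up eE.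
have nU : \forall q \near p, U q by exact: open_nbhs_nbhs.
have dU g : (forall q, U q -> has_partials g q) -> \forall q \near p, derivable g q e.
  move=> Ug; apply: filterS nU => q /Ug /has_partialsE [dx dy].
  by case: eE => ->; [exact: dx|exact: dy].
have [_ _ _ [c0 cx cy [cxx cyx cxy cyy]]] := Uf _ Up.
have DE g : 'D_e g = partial_x g \/ 'D_e g = partial_y g.
  by case: eE => ->; [left; rewrite partial_xE|right; rewrite partial_yE].
split; split.
- by apply: dU => q /Uf [].
- exact: c0.
- by case: (DE f) => ->; [exact: cx|exact: cy].
- by apply: dU => q /Uf [].
- exact: cx.
- by case: (DE (partial_x f)) => ->; [exact: cxx|exact: cyx].
- by apply: dU => q /Uf [].
- exact: cy.
- by case: (DE (partial_y f)) => ->; [exact: cxy|exact: cyy].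
Qed.

Definition slope_x f p : R := partial_x f p - p.2.
Definition slope_y f p : R := partial_y f p + p.1.
(** The squared length of the vector that [Nfield] normalizes; where it is positive the
    normalization is genuine. *)
Definition slope2 f p : R := slope_x f p ^+ 2 + slope_y f p ^+ 2.

(** The derivative of the inverse square root, in the shape delivered by the rule for inverses. *)
Let dinv_sqrt (z : R) : R := - (Num.sqrt z) ^- 2 * (2 * Num.sqrt z)^-1.

Let is_derive_inv_sqrt (z : R) : 0 < z ->
  is_derive z 1 (fun t : R => (Num.sqrt t)^-1) (dinv_sqrt z).
Proof.
move=> z0; have ds := is_derive1_sqrt z0.
have sz : Num.sqrt z != 0 by rewrite gt_eqF// sqrtr_gt0.
split; first by apply: derivableV.
by rewrite deriveV// derive_val.
Qed.

Let continuous_dinv_sqrt (z : R) : 0 < z -> {for z, continuous dinv_sqrt}.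
Proof.
move=> z0; have sz : Num.sqrt z != 0 by rewrite gt_eqF// sqrtr_gt0.
have cs : Num.sqrt t @[t --> z] --> Num.sqrt z by exact: sqrt_continuous.
apply: cvgM.
  apply: cvgN; apply: cvgV; first by rewrite expf_neq0.
  by rewrite expr2; apply: cvgM.
apply: cvgV; first by rewrite mulf_neq0.
by apply: cvgM => //; exact: cvg_cst.
Qed.

Lemma C1at_Nfield e f p : C1at e (partial_x f) p -> C1at e (partial_y f) p ->
  0 < slope2 f p ->
  C1at e (fun q => (Nfield f q).1) p /\ C1at e (fun q => (Nfield f q).2) p.
Proof.
move=> cx cy s0.
have cX : C1at e (slope_x f) p := C1atB cx (C1at_snd e p).
have cY : C1at e (slope_y f) p := C1atD cy (C1at_fst e p).
have cS : C1at e (slope2 f) p by exact: (C1atD (C1atM cX cX) (C1atM cY cY)).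
have cI : C1at e ((fun t : R => (Num.sqrt t)^-1) \o slope2 f) p.
  apply: (C1at_comp cS (dphi := dinv_sqrt)); last exact: continuous_dinv_sqrt.
  by near=> z; apply: is_derive_inv_sqrt; near: z; exact: lt_nbhsr.
by split; [exact: (C1atM cX cI)|exact: (C1atM cY cI)].
Unshelve. all: by end_near. Qed.

Lemma Nfield_unit f p : 0 < slope2 f p ->
  (Nfield f p).1 ^+ 2 + (Nfield f p).2 ^+ 2 = 1.
Proof.
move=> s0; rewrite /= -/(slope_x f p) -/(slope_y f p) -/(slope2 f p).
by rewrite !expr_div_n sqr_sqrtr ?ltW// -mulrDl divff// gt_eqF.
Qed.

Lemma slopeE f p : 0 < slope2 f p ->
  slope_x f p = Num.sqrt (slope2 f p) * (Nfield f p).1 /\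
  slope_y f p = Num.sqrt (slope2 f p) * (Nfield f p).2.
Proof.
move=> s0; rewrite /= -/(slope_x f p) -/(slope_y f p) -/(slope2 f p).
by split; rewrite mulrC divfK// gt_eqF// sqrtr_gt0.
Qed.

(* With [X = s n] and [X' = s' m] for unit vectors [n] and [m],
   [(n - m) . (X - X') = (s + s') / 2 * |n - m|^2]. *)
Let unit_monotone (s s' n1 n2 m1 m2 : R) :
  n1 ^+ 2 + n2 ^+ 2 = 1 -> m1 ^+ 2 + m2 ^+ 2 = 1 ->
  (n1 - m1) * (s * n1 - s' * m1) + (n2 - m2) * (s * n2 - s' * m2) =
  (s + s') / 2 * ((n1 - m1) ^+ 2 + (n2 - m2) ^+ 2).
Proof.
move=> n m.
have -> : (n1 - m1) * (s * n1 - s' * m1) + (n2 - m2) * (s * n2 - s' * m2) =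
  s * (n1 ^+ 2 + n2 ^+ 2) + s' * (m1 ^+ 2 + m2 ^+ 2) - (s + s') * (n1 * m1 + n2 * m2).
  by ring.
have -> : (n1 - m1) ^+ 2 + (n2 - m2) ^+ 2 =
  (n1 ^+ 2 + n2 ^+ 2) + (m1 ^+ 2 + m2 ^+ 2) - 2 * (n1 * m1 + n2 * m2) by ring.
(* Both sides equal [(s + s') * (1 - (n1 * m1 + n2 * m2))]. *)
by rewrite m n; field.
Qed.

(** This is the strict monotonicity of the normalization: both lengths being positive, the pairing
    vanishes only if the two unit vectors agree. *)
Lemma Nfield_monotone f g p : 0 < slope2 f p -> 0 < slope2 g p ->
  ((Nfield f p).1 - (Nfield g p).1) * (slope_x f p - slope_x g p) +
  ((Nfield f p).2 - (Nfield g p).2) * (slope_y f p - slope_y g p) =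
  (Num.sqrt (slope2 f p) + Num.sqrt (slope2 g p)) / 2 *
  (((Nfield f p).1 - (Nfield g p).1) ^+ 2 + ((Nfield f p).2 - (Nfield g p).2) ^+ 2).
Proof.
move=> sf sg; have [fx fy] := slopeE sf; have [gx gy] := slopeE sg.
by rewrite fx fy gx gy; apply: unit_monotone; exact: Nfield_unit.
Qed.

Lemma Nfield_le1 f p : 0 < slope2 f p ->
  `|(Nfield f p).1| <= 1 /\ `|(Nfield f p).2| <= 1.
Proof.
move=> s0; have := Nfield_unit s0; move: (Nfield f p) => [n m] /= nm.
by split; rewrite -(@expr_le1 _ 2)// real_normK ?num_real// -nm ?lerDl ?lerDr sqr_ge0.
Qed.

End Partials.

(** * The integral argument *)

Section ZeroExtension.
Context {R : realType} (W : set (R * R)) (g : R * R -> R).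
Hypothesis Wo : open W.
Hypothesis g0 : forall q, ~ W q -> \forall q' \near q, W q' -> g q' = 0.

Definition zero_ext : R * R -> R := fun q => if `[< W q >] then g q else 0.

Let near_in q : W q -> {near q, g =1 zero_ext}.
Proof.
move=> Wq; have nW : \forall q' \near q, W q' by exact: open_nbhs_nbhs.
by apply: filterS nW => q' Wq'; rewrite /zero_ext asboolT.
Qed.

Let near_out q : ~ W q -> {near q, cst 0 =1 zero_ext}.
Proof.
move=> /g0; apply: filterS => q' gq'; rewrite /zero_ext.
by case: asboolP => // /gq' ->.
Qed.

(** Near each point the extension coincides either with [g] or with the zero function. *)
Lemma C1at_zero_ext e : (forall q, W q -> C1at e g q) -> forall q, C1at e zero_ext q.
Proof.
move=> Cg q; have [Wq|nWq] := pselect (W q).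
  exact: C1at_near_eq (near_in Wq) (Cg _ Wq).
exact: C1at_near_eq (near_out nWq) (C1at_cst _ _ _).
Qed.

Lemma derive_zero_ext_in e q : W q -> 'D_e zero_ext q = 'D_e g q.
Proof. by move=> Wq; apply/esym/near_eq_derive; exact: near_in. Qed.

Lemma derive_zero_ext_out e q : ~ W q -> 'D_e zero_ext q = 0.
Proof.
move=> nWq; rewrite -(derive_cst (0 : R) q e).
by apply/esym/near_eq_derive; exact: near_out.
Qed.

Lemma zero_ext_out q : ~ W q -> zero_ext q = 0.
Proof. by move=> nWq; rewrite /zero_ext asboolF. Qed.

End ZeroExtension.

Lemma exists_lower_bound {R : realType} n (r : nat -> R) : (forall i, 0 < r i) ->
  exists2 m : R, 0 < m & forall i, (i < n)%N -> m <= r i.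
Proof.
move=> r0; elim: n => [|n [m m0 mr]]; first by exists 1.
exists (Num.min m (r n)); first by rewrite lt_min m0 r0.
move=> i; rewrite ltnS leq_eqVlt => /predU1P[->|/mr mi]; rewrite ge_min ?lexx ?orbT//.
by rewrite mi.
Qed.

Lemma le_sqr_nonneg {R : realDomainType} (x y : R) : 0 <= x -> x <= y -> x ^+ 2 <= y ^+ 2.
Proof. by move=> x0 xy; rewrite lerXn2r ?nnegrE//; exact: le_trans xy. Qed.

(** The contradiction is quantitative. Near [p] the tested divergence has grid mass at least
    [c * rho ^+ 2], the squares around [Z] cost at most a quarter of this, yet fine grid sums of the
    whole divergence are at most another quarter. *)
Lemma vanishing_of_divergence_ge0 {R : realType} (Omega Z : set (R * R)) (M : R)
    (w F1 F2 : R * R -> R) (p : R * R) :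
  open Omega -> Omega `<=` ball 0 M -> compact Z -> hausdorff1 Z = 0%E ->
  (forall q e, (Omega `\` Z) q -> e = (1, 0) \/ e = (0, 1) ->
    [/\ C1at e w q, C1at e F1 q & C1at e F2 q]) ->
  (forall q, (Omega `\` Z) q -> `|F1 q| <= 2 /\ `|F2 q| <= 2) ->
  (forall q, (Omega `\` Z) q -> 0 <= 'D_(1, 0) F1 q + 'D_(0, 1) F2 q) ->
  (forall q, (Omega `\` Z) q -> 0 <= F1 q * 'D_(1, 0) w q + F2 q * 'D_(0, 1) w q) ->
  (forall q eps, ~ Omega q -> ~ Z q -> 0 < eps ->
    \forall q' \near q, (Omega `\` Z) q' -> w q' < eps) ->
  Omega p -> 0 < w p -> {for p, continuous w} ->
  ~ exists2 c : R, 0 < c & \forall q \near p, (Omega `\` Z) q ->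
      c <= F1 q * 'D_(1, 0) w q + F2 q * 'D_(0, 1) w q.
Proof.
move=> Oo OM cZ HZ CW Fle2 divF Fw bdry Op wp0 wc [c0 c00 Hc0].
set W := Omega `\` Z in CW Fle2 divF Fw bdry Hc0.
have clZ : closed Z.
  by apply: compact_closed cZ; exact: norm_hausdorff.
have Wo : open W by rewrite /W setDE; apply: openI => //; exact: closed_openC.
(* This sends [w p] to [1 / 2], where [drise] is positive, and values below [w p / 2] to negative
   numbers, where [rise] vanishes. *)
pose s t : R := t / w p - 1 / 2.
pose phi : R -> R := rise \o s.
pose dphi t : R := drise (s t) / w p.
have wp_neq0 : w p != 0 by rewrite gt_eqF.
have dphiP (t : R) : is_derive t 1 phi (dphi t).
  have ds : is_derive t 1 s (w p)^-1.
    have -> : s = (w p)^-1 *: (id : R -> R) - cst (1 / 2).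
      by apply/funext => x; rewrite /s mulrC.
    by apply: is_derive_eq (is_deriveB (is_deriveZ _ (is_derive_id t 1))
      (is_derive_cst (1 / 2 : R) t 1)) _; rewrite subr0 [LHS]mulr1.
  exact: (@is_derive1_comp _ rise s _ _ _ (is_derive_rise _) ds).
have dphic : continuous dphi.
  move=> t; apply: cvgM; last exact: cvg_cst.
  have cs : {for t, continuous s}.
    by apply: cvgB; last exact: cvg_cst; apply: cvgM; [exact: cvg_id|exact: cvg_cst].
  by apply: (@continuous_comp _ _ _ s drise _ cs); exact: continuous_drise.
have dphi_ge0 t : 0 <= dphi t by rewrite mulr_ge0 ?drise_ge0// invr_ge0 ltW.
have dphi_p : 0 < dphi (w p).
  by rewrite divr_gt0// drise_gt0// /s divff//; lra.
have phi01 t : 0 <= phi t <= 1 by rewrite /phi /= rise_ge0 rise_le1.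
have phi0 t : t < w p / 2 -> phi t = 0.
  move=> tw; rewrite /phi /= rise_eq0// /s subr_le0 ler_pdivrMr// mulrC.
  by rewrite mulrA mulr1 ltW.
(* By continuity [dphi (w q)] exceeds half its value at [p] for [q] near [p], and the pairing there
   is at least [c0]. *)
pose c := dphi (w p) / 2 * c0.
have c_gt0 : 0 < c by rewrite mulr_gt0// divr_gt0.
have [rho rho0 Hrho] : exists2 rho : R, 0 < rho & forall q, ball p rho q ->
    Omega q /\ (W q -> c <= dphi (w q) * (F1 q * 'D_(1, 0) w q + F2 q * 'D_(0, 1) w q)).
  have nO : \forall q \near p, Omega q by exact: open_nbhs_nbhs.
  have cdw : {for p, continuous (dphi \o w)} by apply: continuous_comp => //; exact: dphic.
  have nd : \forall q \near p, dphi (w p) / 2 < dphi (w q).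
    have /cvgr_gt/(_ (dphi (w p) / 2)) := cdw; apply.
    by rewrite ltr_pdivrMr// ltr_pMr// ltr1n.
  have : \forall q \near p, Omega q /\ (W q -> c <= dphi (w q) *
      (F1 q * 'D_(1, 0) w q + F2 q * 'D_(0, 1) w q)).
    near=> q; split; first by near: q.
    move=> Wq; rewrite /c ler_pM//; [by rewrite divr_ge0// ltW|exact: ltW| |].
      by apply: ltW; near: q.
    by move: Wq; near: q.
  by move=> /nbhs_ballP [rho /= rho0 H]; exists rho.
(* The square is enlarged to contain the ball of radius [rho] about [p] as well, as its node count
   from below requires. *)
pose M' : R := `|M| + `|p.1| + `|p.2| + rho.
have M'0 : 0 < M' by rewrite ltr_wpDl// !addr_ge0.
have OM' : Omega `<=` ball 0 M'.
  apply: (subset_trans OM); apply: le_ball; rewrite (le_trans (ler_norm _))//.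
  by rewrite /M' -!addrA lerDl !addr_ge0// ltW.
(* For [r <= 1] a doubled square costs at most [L * r]: density [c + 128 / r] times grid mass at
   most [25 * r ^+ 2]. The choice of [tau] keeps radii at most [1] and the total cost at most
   [c * rho ^+ 2 / 4]. *)
have [L L0 LE] : exists2 L : R, 0 < L & L = 25 * c + 3200.
  by exists (25 * c + 3200); [lra|].
pose tau : R := Num.min 1 (c * rho ^+ 2 / 4 / L).
have tau0 : 0 < tau by rewrite lt_min ltr01 !divr_gt0// mulr_gt0// exprn_gt0.
have tau1 : tau <= 1 by rewrite ge_min lexx.
have tauK : L * tau <= c * rho ^+ 2 / 4.
  by rewrite mulrC -ler_pdivlMr// ge_min lexx orbT.
have [n [x [r [r0 Zx rtau]]]] := hausdorff1_eq0_cover cZ HZ tau0.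
have [eta [Ceta eta01 eta0 eta1 deta]] := cutoff_squares n x r0.
pose psi : R * R -> R := (phi \o w) * eta.
have psiE q : psi q = phi (w q) * eta q by [].
(* Near [Z] the factor [eta] vanishes; near other points outside [Omega], [w] is below [w p / 2] on
   [W], so [phi] vanishes. *)
have psi0 q : ~ W q -> \forall q' \near q, W q' -> psi q' = 0.
  move=> nWq; have [Zq|nZq] := pselect (Z q).
    have [i ilt qi] := Zx _ Zq.
    have ob : open (ball (x i) (r i)) by exact: ball_open.
    have := open_nbhs_nbhs (conj ob qi); apply: filterS => q' /(eta0 _ _ ilt) e0 _.
    by rewrite psiE e0 mulr0.
  have nOq : ~ Omega q by move=> Oq; apply: nWq.
  have w20 : 0 < w p / 2 by rewrite divr_gt0.
  have := bdry q _ nOq nZq w20; apply: filterS => q' H /H /phi0 e0.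
  by rewrite psiE e0 mul0r.
have Cpsi q e : W q -> e = (1, 0) \/ e = (0, 1) -> C1at e psi q.
  move=> Wq he; have [Cw _ _] := CW q e Wq he.
  have Cphi : C1at e (phi \o w) q.
    apply: (C1at_comp Cw (dphi := dphi)); last exact: dphic.
    by near=> z; exact: dphiP.
  exact: (C1atM Cphi (Ceta e q)).
have Fpsi0 (F : R * R -> R) q : ~ W q -> \forall q' \near q, W q' -> (psi * F) q' = 0.
  move=> /psi0; apply: filterS => q' H /H e0.
  by have -> : (psi * F) q' = psi q' * F q' by []; rewrite e0 mul0r.
pose G1 := zero_ext W (psi * F1); pose G2 := zero_ext W (psi * F2).
have CG1 q : C1at (1, 0) G1 q.
  apply: C1at_zero_ext => //; first exact: Fpsi0.
  move=> q' Wq'; have he : (1, 0) = (1, 0) :> R * R \/ (1, 0) = (0, 1) :> R * R by left.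
  by have [_ CF _] := CW q' _ Wq' he; exact: (C1atM (Cpsi _ _ Wq' he) CF).
have CG2 q : C1at (0, 1) G2 q.
  apply: C1at_zero_ext => //; first exact: Fpsi0.
  move=> q' Wq'; have he : (0, 1) = (1, 0) :> R * R \/ (0, 1) = (0, 1) :> R * R by right.
  by have [_ _ CF] := CW q' _ Wq' he; exact: (C1atM (Cpsi _ _ Wq' he) CF).
have G0 q : ~ ball 0 M' q -> G1 q = 0 /\ G2 q = 0.
  move=> qM; have nWq : ~ W q by move=> [/OM'].
  by split; exact: zero_ext_out.
(* A pointwise minorant of the divergence. In each penalty [c] pays for [eta] falling below [1], and
   [128 / r i] is [2 * 2 * 32 / r i]: two components of the field, each at most [2], against
   derivatives of [eta]. *)
pose lower : R * R -> R :=
  c *: \1_(ball p rho) + \sum_(i < n) (- (c + 128 / r i)) *: \1_(ball (x i) (2 * r i)).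
have lowerE q : lower q = c * \1_(ball p rho) q -
    \sum_(i < n) (c + 128 / r i) * \1_(ball (x i) (2 * r i)) q.
  rewrite /lower [LHS]/(_ + _) fct_sumE -sumrN; congr (_ + _).
  by apply: eq_bigr => i _; rewrite -mulNr.
have coef_ge0 i : 0 <= c + 128 / r i by rewrite addr_ge0 ?ltW// divr_gt0.
have ind_ge0 (A : set (R * R)) q : 0 <= \1_A q :> R by rewrite indicE.
have key q : lower q <= ('D_(1, 0) G1 + 'D_(0, 1) G2) q.
  have DGE : ('D_(1, 0) G1 + 'D_(0, 1) G2) q = 'D_(1, 0) G1 q + 'D_(0, 1) G2 q by [].
  rewrite lowerE DGE.
  have [Wq|nWq] := pselect (W q); last first.
    have -> : 'D_(1, 0) G1 q = 0 := derive_zero_ext_out (Fpsi0 F1) _ nWq.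
    have -> : 'D_(0, 1) G2 q = 0 := derive_zero_ext_out (Fpsi0 F2) _ nWq.
    rewrite addr0 subr_le0 [X in c * X]indicE.
    have [|_] := boolP (q \in _); last first.
      by rewrite mulr0n mulr0 sumr_ge0// => i _; rewrite mulr_ge0.
    rewrite inE mulr1 => /Hrho[Oq _].
    (* Such a point near [p] lies in a covering square, whose penalty of at least [c] offsets the
       gain. *)
    have Zq : Z q by apply: contrapT => nZq; apply: nWq.
    have [i ilt [qi1 qi2]] := Zx _ Zq.
    rewrite (bigD1 (Ordinal ilt))//= ler_wpDr//.
      by rewrite sumr_ge0// => j _; rewrite mulr_ge0.
    rewrite indicE mem_set ?mulr1 ?lerDl ?divr_ge0// ?ltW//.
    have r2 : r i <= 2 * r i by rewrite ler_peMl ?ltW// ltr1n.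
    by split; [apply: lt_le_trans qi1 _|apply: lt_le_trans qi2 _].
  have -> : 'D_(1, 0) G1 q = 'D_(1, 0) (psi * F1) q := derive_zero_ext_in _ Wo _ Wq.
  have -> : 'D_(0, 1) G2 q = 'D_(0, 1) (psi * F2) q := derive_zero_ext_in _ Wo _ Wq.
  have dG e (F : R * R -> R) : e = (1, 0) \/ e = (0, 1) -> C1at e F q ->
      'D_e (psi * F) q = phi (w q) * eta q * 'D_e F q +
        F q * (phi (w q) * 'D_e eta q + eta q * (dphi (w q) * 'D_e w q)).
    move=> he CF; have [Cw _ _] := CW q e Wq he.
    have dpw : is_derive q e (phi \o w) (dphi (w q) * 'D_e w q).
      exact: is_derive_comp_dir (C1at_derivable Cw) (dphiP _).
    have deta' : is_derive q e eta ('D_e eta q).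
      by apply/derivableP/C1at_derivable; exact: Ceta.
    have dF : is_derive q e F ('D_e F q) by apply/derivableP/C1at_derivable.
    exact: (derive_val (is_derive := is_deriveM (is_deriveM dpw deta') dF)).
  have e1 : (1, 0) = (1, 0) :> R * R \/ (1, 0) = (0, 1) :> R * R by left.
  have e2 : (0, 1) = (1, 0) :> R * R \/ (0, 1) = (0, 1) :> R * R by right.
  have [_ CF1 _] := CW q _ Wq e1; have [_ _ CF2] := CW q _ Wq e2.
  rewrite (dG _ _ e1 CF1) (dG _ _ e2 CF2).
  have := divF q Wq; have := Fw q Wq; have [] := Fle2 q Wq.
  have d1 : `|'D_(1, 0) eta q| <= \sum_(i < n) 32 / r i * \1_(ball (x i) (2 * r i)) q.
    by apply: deta; rewrite /= ?normr1 ?normr0.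
  have d2 : `|'D_(0, 1) eta q| <= \sum_(i < n) 32 / r i * \1_(ball (x i) (2 * r i)) q.
    by apply: deta; rewrite /= ?normr1 ?normr0.
  have -> : \sum_(i < n) (c + 128 / r i) * \1_(ball (x i) (2 * r i)) q =
      c * (\sum_(i < n) \1_(ball (x i) (2 * r i)) q) +
      4 * \sum_(i < n) 32 / r i * \1_(ball (x i) (2 * r i)) q.
    rewrite !mulr_sumr -big_split /=; apply: eq_bigr => i _.
    by rewrite mulrDl !mulrA; congr (_ + _ * _ * _); rewrite -natrM.
  have N0 : 0 <= \sum_(i < n) \1_(ball (x i) (2 * r i)) q :> R by rewrite sumr_ge0.
  (* On the ball about [p], [eta] is at least [1] minus the number of doubled squares containing
     [q]; off that ball the left side is at most [0]. *)
  have main : c * \1_(ball p rho) q - c * (\sum_(i < n) \1_(ball (x i) (2 * r i)) q)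
      <= eta q * (dphi (w q) * (F1 q * 'D_(1, 0) w q + F2 q * 'D_(0, 1) w q)).
    have /andP[h0 h1] := eta01 q.
    rewrite [X in c * X - _]indicE; have [|_] := boolP (q \in _).
      rewrite inE => /Hrho[_ /(_ Wq) cle].
      rewrite -mulrBr (le_trans (y := c * eta q))//.
        by rewrite ler_wpM2l ?eta1// ltW.
      by rewrite mulrC ler_wpM2l.
    rewrite mulr0n mulr0 sub0r (le_trans (y := 0))//.
      by rewrite oppr_le0 mulr_ge0// ltW.
    by apply: mulr_ge0 => //; apply: mulr_ge0; [exact: dphi_ge0|exact: Fw].
  have /andP[P0 P1] := phi01 (w q); have /andP[h0 h1] := eta01 q.
  move: main d1 d2 N0 P0 P1 h0 h1.
  move: (\sum_(i < n) _) (\sum_(i < n) _) (dphi (w q)) (\1_(ball p rho) q) => S2 S1 dP I.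
  move: ('D_(1, 0) eta q) ('D_(0, 1) eta q) ('D_(1, 0) w q) ('D_(0, 1) w q).
  move: ('D_(1, 0) F1 q) ('D_(0, 1) F2 q) (F1 q) (F2 q) (eta q) (phi (w q)).
  clear; move=> a1 a2 f1 f2 h P h1 h2 w1 w2 main d1 d2 N0 P0 P1 h0 h1' f1b f2b fw div0.
  have b f h' : `|f| <= 2 -> `|h'| <= S2 -> - (2 * S2) <= P * (f * h').
    move=> fb hb; have : `|P * (f * h')| <= 2 * S2.
      rewrite !normrM (ger0_norm P0); apply: le_trans (ler_pM _ _ fb hb) => //.
      by rewrite ler_piMl// mulr_ge0.
    by rewrite ler_norml => /andP[].
  have b1 := b _ _ f1b d1; have b2 := b _ _ f2b d2.
  have b3 : 0 <= P * h * (a1 + a2) by rewrite !mulr_ge0.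
  (* The three groups are [phi eta div F], which is nonnegative, [eta phi' F . grad w], bounded by
     [main], and [phi F . grad eta], at least [- 4 * S2]. *)
  have -> : P * h * a1 + f1 * (P * h1 + h * (dP * w1)) +
      (P * h * a2 + f2 * (P * h2 + h * (dP * w2))) =
    P * h * (a1 + a2) + h * (dP * (f1 * w1 + f2 * w2)) + (P * (f1 * h1) + P * (f2 * h2)).
    by ring.
  lra.
(* The grid must be finer than every covering square for the mass bounds below. *)
have [m m0 mr] := exists_lower_bound n r0.
have eps0 : 0 < c * rho ^+ 2 / 4 by rewrite divr_gt0// mulr_gt0// exprn_gt0.
have lim0 := gridsum_div_cvg0 M'0 CG1 CG2 G0 eps0.
suff : \forall K \near \oo, False by case=> K0' _ /(_ K0' (leqnn _)).
near=> K.
have [Kgt0 hrho] : (0 < K)%N /\ step M' K < rho by near: K; exact: step_cvg0.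
have [_ hm] : (0 < K)%N /\ step M' K < m by near: K; exact: step_cvg0.
have /ler_normlW gD : `|gridsum M' K ('D_(1, 0) G1 + 'D_(0, 1) G2)| <= c * rho ^+ 2 / 4.
  by near: K.
have h0 := step_gt0 M'0 Kgt0.
have := le_trans (le_gridsum M' K key) gD.
rewrite /lower gridsumD gridsumZ.
rewrite (gridsum_sum M' K n (fun i => (- (c + 128 / r i)) *: \1_(ball (x i) (2 * r i)))).
(* A step below [rho] leaves [2 * rho - step M' K] at least [rho]. *)
have gQ : rho ^+ 2 <= gridsum M' K \1_(ball p rho).
  have pM1 : `|p.1| + rho <= M' by rewrite /M'; have := normr_ge0 M; have := normr_ge0 p.2; lra.
  have pM2 : `|p.2| + rho <= M' by rewrite /M'; have := normr_ge0 M; have := normr_ge0 p.1; lra.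
  have hr2 : step M' K <= 2 * rho by lra.
  apply: le_trans (gridsum_ball_ge M'0 Kgt0 hr2 pM1 pM2).
  by apply: le_sqr_nonneg; [exact: ltW|lra].
have gB : - (L * tau) <= \sum_(i < n) gridsum M' K
    ((- (c + 128 / r i)) *: \1_(ball (x i) (2 * r i))).
  apply: (@le_trans _ _ (\sum_(i < n) - (L * r i))).
    by rewrite sumrN -mulr_sumr lerN2 ler_wpM2l// ltW.
  apply: ler_sum => i _; rewrite gridsumZ mulNr lerN2.
  have ri1 : r i <= 1.
    apply: le_trans tau1; apply: le_trans rtau.
    by rewrite (bigD1 i)//= lerDl sumr_ge0// => j _; exact: ltW.
  have hr : step M' K <= r i by apply: le_trans (ltW hm) (mr _ _).
  have rr : 0 < 2 * r i by rewrite mulr_gt0.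
  apply: (@le_trans _ _ ((c + 128 / r i) * (25 * r i ^+ 2))).
    rewrite ler_wpM2l// (le_trans (gridsum_ball_le M'0 _ Kgt0 rr))//.
    (* The doubled square has side [4 * r i], and one step adds at most [r i]. *)
    have -> : 25 * r i ^+ 2 = (5 * r i) ^+ 2 by ring.
    by have := r0 i => ri0; apply: le_sqr_nonneg; lra.
  have -> : (c + 128 / r i) * (25 * r i ^+ 2) = 25 * c * (r i * r i) + 3200 * r i.
    by field; rewrite gt_eqF.
  have : c * (r i * r i) <= c * r i by rewrite ler_pM2l// ler_piMl// ltW.
  rewrite LE mulrDl => rc.
  by lra.
have gQ' : c * rho ^+ 2 <= c * gridsum M' K \1_(ball p rho) by rewrite ler_pM2l.
by lra.
Unshelve. all: by end_near. Qed.

(** * Comparison of the normalized fields of [u] and [v] *)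

Lemma slope2_gt0 {R : realType} (Omega S0 S : set (R * R)) (f : R * R -> R) q :
  S0 `<=` S -> char_set Omega S0 f `<=` S -> C2_on (Omega `\` S) f ->
  (Omega `\` S) q -> 0 < slope2 f q.
Proof.
move=> S0S chS Cf Wq; have [Oq nSq] := Wq.
rewrite lt0r addr_ge0 ?sqr_ge0// andbT; apply/negP => /eqP s0.
(* If the slope vector vanished, [q] would be characteristic and hence in [S]. *)
apply: (nSq); apply: chS; split; first by split=> // /S0S.
have hx : (1, 0) = (1, 0) :> R * R \/ (1, 0) = (0, 1) :> R * R by left.
have hy : (0, 1) = (1, 0) :> R * R \/ (0, 1) = (0, 1) :> R * R by right.
have [/C1at_derivable dx _ _] := C2_on_C1at Cf Wq hx.
have [/C1at_derivable dy _ _] := C2_on_C1at Cf Wq hy.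
split; first by apply/has_partialsE; split; [exact: dx|exact: dy].
move/eqP: s0; rewrite /slope2 paddr_eq0 ?sqr_ge0// !sqrf_eq0.
by move=> /andP[/eqP ? /eqP ?].
Qed.

Lemma near_lt_within {R : realType} (A : set (R * R)) (f : R * R -> R) q (eps : R) :
  {within A, continuous f} -> A q -> 0 < eps ->
  \forall q' \near q, A q' -> `|f q - f q'| < eps.
Proof.
move=> /subspace_continuousP cf Aq eps0.
have /cvgrPdist_lt/(_ _ eps0) := cf _ Aq.
by rewrite near_withinE.
Qed.

Theorem theorem5p2 (R : realType) (Omega S1 S2 : set (R * R)) (u v : R * R -> R) :
  bounded_domain Omega -> S1 `<=` Omega -> S2 `<=` Omega ->
  {within closure Omega `\` S1, continuous u} ->
  {within closure Omega `\` S2, continuous v} ->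
  let S := S1 `|` S2 `|` char_set Omega S1 u `|` char_set Omega S2 v in
  C2_on (Omega `\` S) u -> C2_on (Omega `\` S) v ->
  hausdorff1 (closure S) = 0%E ->
  (forall p, (Omega `\` S) p -> div (Nfield v) p <= div (Nfield u) p) ->
  (forall p, ((closure Omega `\` Omega) `\` S) p -> u p <= v p) ->
  forall p, (Omega `\` S) p -> v p < u p -> Nfield u p = Nfield v p.
Proof.
move=> [_ Oo _ [M OM]] S1O S2O cu cv S Cu Cv HS divuv bd p Wp vu.
apply: contrapT => Nneq.
have S1S : S1 `<=` S by move=> q ?; left; left; left.
have S2S : S2 `<=` S by move=> q ?; left; left; right.
have chu : char_set Omega S1 u `<=` S by move=> q ?; left; right.
have chv : char_set Omega S2 v `<=` S by move=> q ?; right.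
have SO : S `<=` Omega.
  by move=> q [[[/S1O//|/S2O//]|[[]]]|[[]]].
have sub q : (Omega `\` closure S) q -> (Omega `\` S) q.
  by move=> [Oq nSq]; split; [exact: Oq|move=> /subset_closure].
have su q (Wq : (Omega `\` S) q) := slope2_gt0 S1S chu Cu Wq.
have sv q (Wq : (Omega `\` S) q) := slope2_gt0 S2S chv Cv Wq.
have Obox q : Omega q -> `|q.1| <= M /\ `|q.2| <= M.
  move=> /OM qM; have := coord_le_edist q (0, 0); rewrite !subr0 => -[q1 q2].
  by split; [exact: le_trans q1 qM|exact: le_trans q2 qM].
have OM1 : Omega `<=` ball 0 (M + 1).
  by move=> q /Obox [q1 q2]; apply/ball_prodP; rewrite !sub0r !normrN; split; lra.
have cZ : compact (closure S).
  apply: (subclosed_compact (@closed_closure _ S) (@compact_box R M)).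
  have /closure_id -> : closed ([set` `[- M, M]] `*` [set` `[- M, M]] : set (R * R)).
    by apply: compact_closed (@compact_box R M); exact: norm_hausdorff.
  apply: closure_subset => q /SO/Obox[q1 q2].
  by split; rewrite /= in_itv /= -ler_norml.
pose F1 q := (Nfield u q).1 - (Nfield v q).1.
pose F2 q := (Nfield u q).2 - (Nfield v q).2.
have CF q e : (Omega `\` S) q -> e = (1, 0) \/ e = (0, 1) ->
    [/\ C1at e (u - v) q, C1at e F1 q & C1at e F2 q].
  move=> Wq he.
  have [u0 ux uy] := C2_on_C1at Cu Wq he; have [v0 vx vy] := C2_on_C1at Cv Wq he.
  have [nu1 nu2] := C1at_Nfield ux uy (su q Wq).
  have [nv1 nv2] := C1at_Nfield vx vy (sv q Wq).
  by split; [exact: C1atB u0 v0|exact: C1atB nu1 nv1|exact: C1atB nu2 nv2].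
have hx : (1, 0) = (1, 0) :> R * R \/ (1, 0) = (0, 1) :> R * R by left.
have hy : (0, 1) = (1, 0) :> R * R \/ (0, 1) = (0, 1) :> R * R by right.
(* The terms [- y] and [+ x] cancel in the differences of slopes. *)
have Dw q : (Omega `\` S) q -> 'D_(1, 0) (u - v) q = slope_x u q - slope_x v q /\
    'D_(0, 1) (u - v) q = slope_y u q - slope_y v q.
  move=> Wq; split.
    have [/C1at_derivable du _ _] := C2_on_C1at Cu Wq hx.
    have [/C1at_derivable dv _ _] := C2_on_C1at Cv Wq hx.
    by rewrite (deriveB du dv) /slope_x !partial_xE; ring.
  have [/C1at_derivable du _ _] := C2_on_C1at Cu Wq hy.
  have [/C1at_derivable dv _ _] := C2_on_C1at Cv Wq hy.
  by rewrite (deriveB du dv) /slope_y !partial_yE; ring.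
pose g q := F1 q * (slope_x u q - slope_x v q) + F2 q * (slope_y u q - slope_y v q).
have gE q : (Omega `\` S) q ->
    F1 q * 'D_(1, 0) (u - v) q + F2 q * 'D_(0, 1) (u - v) q = g q.
  by move=> /Dw [-> ->].
have gM q : (Omega `\` S) q -> g q =
    (Num.sqrt (slope2 u q) + Num.sqrt (slope2 v q)) / 2 * (F1 q ^+ 2 + F2 q ^+ 2).
  by move=> Wq; exact: Nfield_monotone (su q Wq) (sv q Wq).
(* The point [p] avoids [S] but may lie in its closure. [C2_on] provides regularity on an open set
   containing [p], so [g] is continuous there all the same. *)
have cg : {for p, continuous g}.
  have [_ [_ cF1 _] [_ cF2 _]] := CF p _ Wp hx.
  have [_ [_ ux _] [_ uy _]] := C2_on_C1at Cu Wp hx.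
  have [_ [_ vx _] [_ vy _]] := C2_on_C1at Cv Wp hx.
  have [_ cfst _] := C1at_fst (1, 0) p; have [_ csnd _] := C1at_snd (1, 0) p.
  exact: (cvgD (cvgM cF1 (cvgB (cvgB ux csnd) (cvgB vx csnd)))
    (cvgM cF2 (cvgB (cvgD uy cfst) (cvgD vy cfst)))).
have norms_gt0 q : (Omega `\` S) q ->
    0 < (Num.sqrt (slope2 u q) + Num.sqrt (slope2 v q)) / 2.
  by move=> Wq; apply: divr_gt0 => //; apply: addr_gt0; rewrite sqrtr_gt0;
    [exact: su|exact: sv].
have gp : 0 < g p.
  rewrite (gM _ Wp); apply: mulr_gt0; first exact: norms_gt0.
  rewrite lt0r addr_ge0 ?sqr_ge0// andbT; apply/negP => /eqP/eqP.
  rewrite paddr_eq0 ?sqr_ge0// !sqrf_eq0 !subr_eq0 => /andP[/eqP N1 /eqP N2].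
  by apply: Nneq; rewrite (surjective_pairing (Nfield u p)) N1 N2 -surjective_pairing.
have [[_ cw _] _ _] := CF p _ Wp hx.
have wp : 0 < (u - v) p by rewrite [ltRHS]/(u p - v p) subr_gt0.
apply: (vanishing_of_divergence_ge0 (F1 := F1) (F2 := F2) Oo OM1 cZ HS _ _ _ _ _
  Wp.1 wp cw).
- by move=> q e /sub; exact: CF.
- move=> q /sub Wq; have [u1 u2] := Nfield_le1 (su q Wq).
  have [v1 v2] := Nfield_le1 (sv q Wq).
  have le2 (a b : R) : `|a| <= 1 -> `|b| <= 1 -> `|a - b| <= 2.
    by move=> a1 b1; apply: (le_trans (ler_normB _ _)); clear -a1 b1; lra.
  by split; [exact: le2 u1 v1|exact: le2 u2 v2].
- move=> q /sub Wq; have := divuv q Wq.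
  have [_ F1x _] := CF q _ Wq hx; have [_ _ F2y] := CF q _ Wq hy.
  have [_ ux uy] := C2_on_C1at Cu Wq hx; have [_ vx vy] := C2_on_C1at Cv Wq hx.
  have [_ ux' uy'] := C2_on_C1at Cu Wq hy; have [_ vx' vy'] := C2_on_C1at Cv Wq hy.
  have [/C1at_derivable nu1 _] := C1at_Nfield ux uy (su q Wq).
  have [/C1at_derivable nv1 _] := C1at_Nfield vx vy (sv q Wq).
  have [_ /C1at_derivable nu2] := C1at_Nfield ux' uy' (su q Wq).
  have [_ /C1at_derivable nv2] := C1at_Nfield vx' vy' (sv q Wq).
  have F1E : F1 = (fun q => (Nfield u q).1) - (fun q => (Nfield v q).1) by [].
  have F2E : F2 = (fun q => (Nfield u q).2) - (fun q => (Nfield v q).2) by [].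
  rewrite F1E F2E (deriveB nu1 nv1) (deriveB nu2 nv2) /div !partial_xE !partial_yE.
  have le_sub (a b c d : R) : b + d <= a + c -> 0 <= a - b + (c - d).
    by clear; lra.
  exact: le_sub.
- move=> q /sub Wq; rewrite (gE _ Wq) (gM _ Wq); apply: mulr_ge0.
    exact: ltW (norms_gt0 _ Wq).
  by apply: addr_ge0; exact: sqr_ge0.
- move=> q eps nOq nZq eps0; have nSq : ~ S q by move=> /subset_closure.
  (* Off the closure of [Omega] the claim is vacuous near [q]; at a boundary point [u q <= v q], and
     each function varies by less than [eps / 2]. *)
  have [cOq|ncOq] := pselect (closure Omega q); last first.
    have : \forall q' \near q, (~` closure Omega) q'.
      apply: open_nbhs_nbhs; split; last exact: ncOq.
      by apply: closed_openC; exact: closed_closure.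
    by apply: filterS => q' nq' [/subset_closure].
  have uv : u q <= v q by apply: bd; split.
  have e2 : 0 < eps / 2 by rewrite divr_gt0.
  have nu : \forall q' \near q, (closure Omega `\` S1) q' -> `|u q - u q'| < eps / 2.
    apply: (near_lt_within cu _ e2); split; [exact: cOq|by move=> /S1S].
  have nv : \forall q' \near q, (closure Omega `\` S2) q' -> `|v q - v q'| < eps / 2.
    apply: (near_lt_within cv _ e2); split; [exact: cOq|by move=> /S2S].
  apply: filterS2 nu nv => q' Hu Hv /sub [Oq' nSq'].
  have {Hu} : `|u q - u q'| < eps / 2.
    by apply: Hu; split; [exact: subset_closure|move=> /S1S].
  have {Hv} : `|v q - v q'| < eps / 2.
    by apply: Hv; split; [exact: subset_closure|move=> /S2S].
  have -> : (u - v) q' = u q' - v q' by [].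
  move: (u q) (v q) (u q') (v q') uv; clear; move=> a b a' b' ab.
  by rewrite !ltr_norml => /andP[? ?] /andP[? ?]; lra.
- exists (g p / 2); first by rewrite divr_gt0.
  have /cvgr_gt/(_ (g p / 2)) ng : g x @[x --> p] --> g p by exact: cg.
  have : \forall q \near p, g p / 2 < g q.
    by apply: ng; rewrite ltr_pdivrMr// ltr_pMr// ltr1n.
  by apply: filterS => q gq /sub Wq; rewrite (gE _ Wq) ltW.
Qed.
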